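(* There is an absolute constant $C>0$ such that the following holds. Let $\mathcal{K}\subset\mathbb{R}^d$ be a compact $\rho$-smooth convex body, and let $0<r\le\rho\le R$ be known radii with $\mathbb{B}(0,r)\subseteq\mathcal{K}\subseteq\mathbb{B}(0,R)$. Suppose an exact membership oracle for $\mathcal{K}$ is available. Let $f$ be $\beta$-smooth and $\alpha$-strongly convex on $\mathcal{K}$ ($\alpha,\beta>0$), let $f^\star:=\min_{x\in\mathcal{K}}f(x)$, let $x_0\in\mathcal{K}$, and suppose that $$f(x_0)-f^\star\le H_0,\qquad \sup_{x\in\mathcal{K}}\|\nabla f(x)\|\le G.$$ Write $\gamma:=\alpha/\beta$ and $\Gamma:=G/(\alpha\rho)$. Then for every $0<\varepsilon<H_0$, the shrinking-radius method (defined in the context), with its local-oracle calls implemented deterministically by membership queries, produces $x_T\in\mathcal{K}$ with $f(x_T)-f^\star\le\varepsilon$ after a number of iterations $$1\le T\le\Big\lceil C\,(\gamma^{-1}+\Gamma)\log\frac{H_0}{\varepsilon}\Big\rceil .$$ Each of these $T$ iterations uses one objective gradient and at most $C\,d\log Q_\varepsilon$ exact membership queries, where $$Q_\varepsilon=d+\frac{R}{r}+\frac{\alpha R^2(1+\Gamma)^2}{\varepsilon}.$$ Hence the total number of membership queries is at most $C\,d\,T\log Q_\varepsilon$. The method uses no objective values, no projection onto $\mathcal{K}$, and no local or global linear-optimization oracle: it accesses $f$ only through gradients at the iterates and $\mathcal{K}$ only through membership queries (together with the known $x_0$ and parameters $\rho,r,R,\alpha,\beta,G,H_0$).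
   Context: $\|\cdot\|$ and $\langle\cdot,\cdot\rangle$ are the Euclidean norm and inner product on $\mathbb{R}^d$; $\mathbb{B}(x,s)$ is the closed Euclidean ball of radius $s$ centered at $x$. A convex body is a compact convex set with nonempty interior. $\rho$-smooth set: a convex body $\mathcal{K}$ is $\rho$-smooth if for every $q\in\partial\mathcal{K}$ and every outward supporting unit normal $n$ at $q$ (a unit vector with $\langle n,z-q\rangle\le 0$ for all $z\in\mathcal{K}$) one has $\mathbb{B}(q-\rho n,\rho)\subseteq\mathcal{K}$. Conventions on $f$: $f$ is differentiable on a neighborhood of $\mathcal{K}$; $\beta$-smooth on $\mathcal{K}$ means $\nabla f$ is $\beta$-Lipschitz on $\mathcal{K}$; $\alpha$-strongly convex on $\mathcal{K}$ means $f(y)\ge f(x)+\langle\nabla f(x),y-x\rangle+\frac{\alpha}{2}\|y-x\|^2$ for all $x,y\in\mathcal{K}$. Exact membership oracle: given $z\in\mathbb{R}^d$, it returns $\mathbf{1}\{z\in\mathcal{K}\}$. Queries may be adaptive, and computation is in exact real arithmetic. Shrinking-radius method: let $D=2R$ (an upper bound on $\operatorname{diam}(\mathcal{K})$), $\kappa=\beta/\alpha$, $a=9/\rho$, $b=aG/\alpha$, $\theta=\frac{1}{4(1+b)}$, $\eta=\frac{1+b}{1+b+\kappa}$, $\sigma=\frac{1}{16(1+b+\kappa)}$, $\Delta_t=(1-\sigma)^tH_0$, and $s_t=\min\{D,\ \theta\sqrt{2\Delta_t/\alpha}\}$. For $t=0,1,2,\dots$: with $c_t=\nabla f(x_t)$,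 a local-oracle call computes a point $p_t\in\mathcal{K}\cap\mathbb{B}(x_t,s_t)$ with $\langle c_t,p_t\rangle\le\min_{z\in\mathcal{K}\cap\mathbb{B}(x_t,s_t)}\langle c_t,z\rangle+a\|c_t\|s_t^2$, and $x_{t+1}=x_t+\eta(p_t-x_t)$. ''Implemented deterministically by membership queries'' means that $p_t$ is computed by a deterministic procedure from $x_t,s_t,c_t$, the known parameters and the answers to (adaptive) membership queries. *)

(* Defs.v *)
From HB Require Import structures.
From mathcomp Require Import all_boot all_order all_algebra.
From mathcomp Require Import all_classical all_reals all_analysis.

Set Implicit Arguments.
Unset Strict Implicit.
Unset Printing Implicit Defensive.

Import Order.TTheory GRing.Theory Num.Theory.
Import numFieldNormedType.Exports.

Local Open Scope classical_set_scope.
Local Open Scope ring_scope.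

Section Euclidean.
Context {R : realType} {d : nat}.
Implicit Types (x y u v c : 'rV[R]_d) (K : set 'rV[R]_d).

(* The library norm `|x| on 'rV[R]_d is the sup norm, so the Euclidean inner
   product, norm and balls are defined here. Both norms induce the same
   topology: compactness, interior, closure and differentiability are the
   library's. *)
Definition inner u v : R := \sum_(i < d) u 0 i * v 0 i.

Definition enorm u : R := Num.sqrt (inner u u).

Definition eball x (s : R) : set 'rV[R]_d := [set z | enorm (z - x) <= s].

Definition frontier K : set 'rV[R]_d := closure K `\` interior K.

Definition convex_body K : Prop :=
  [/\ compact K, convex_set (K : set (convex_lmodType 'rV[R]_d))
    & interior K !=set0].

Definition outward_unit_normal K q n : Prop :=
  enorm n = 1 /\ forall z, K z -> inner n (z - q) <= 0.

Definition smooth_body (rho : R) K : Prop :=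
  convex_body K /\
  forall q n, frontier K q -> outward_unit_normal K q n ->
    eball (q - rho *: n) rho `<=` K.

Definition is_min_on (A : set 'rV[R]_d) (g : 'rV[R]_d -> R) (m : R) : Prop :=
  (exists2 z, A z & g z = m) /\ forall z, A z -> m <= g z.

(* Riesz representative, for [inner], of the differential of f at x. *)
Definition grad (f : 'rV[R]_d -> R) x : 'rV[R]_d :=
  \row_(i < d) 'd (f : 'rV[R]_d -> R^o) x (delta_mx 0 i).

Definition differentiable_around K (f : 'rV[R]_d -> R) : Prop :=
  exists2 U : set 'rV[R]_d, open U /\ K `<=` U &
    forall x, U x -> differentiable (f : 'rV[R]_d -> R^o) x.

Definition smooth_on K (beta : R) (f : 'rV[R]_d -> R) : Prop :=
  forall x y, K x -> K y ->
    enorm (grad f x - grad f y) <= beta * enorm (x - y).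

Definition strongly_convex_on K (alpha : R) (f : 'rV[R]_d -> R) : Prop :=
  forall x y, K x -> K y ->
    f x + inner (grad f x) (y - x) + alpha / 2 * enorm (y - x) ^+ 2 <= f y.

End Euclidean.

(* Deterministic computations with adaptive access to a membership oracle and
   a gradient oracle: between two calls, the next call (or the returned value)
   is an arbitrary exact function of the answers received so far. Being
   inductive, every such computation makes finitely many calls. *)
Inductive oracle_comp (R : realType) (d : nat) (A : Type) : Type :=
| Ret of A
| AskMem of 'rV[R]_d & (bool -> oracle_comp R d A)
| AskGrad of 'rV[R]_d & ('rV[R]_d -> oracle_comp R d A).

Arguments Ret {R d A} _.
Arguments AskMem {R d A} _ _.
Arguments AskGrad {R d A} _ _.

Section OracleComputations.
Context {R : realType} {d : nat}.

Fixpoint bind (A B : Type) (m : oracle_comp R d A)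
    (h : A -> oracle_comp R d B) : oracle_comp R d B :=
  match m with
  | Ret a => h a
  | AskMem z k => AskMem z (fun b => bind (k b) h)
  | AskGrad x k => AskGrad x (fun c => bind (k c) h)
  end.

Fixpoint membership_only (A : Type) (m : oracle_comp R d A) : Prop :=
  match m with
  | Ret _ => True
  | AskMem _ k => forall b, membership_only (k b)
  | AskGrad _ _ => False
  end.

Section Execution.
Variables (K : set 'rV[R]_d) (f : 'rV[R]_d -> R).

Fixpoint result (A : Type) (m : oracle_comp R d A) : A :=
  match m with
  | Ret a => a
  | AskMem z k => result (k `[< K z >])
  | AskGrad x k => result (k (grad f x))
  end.

Fixpoint mem_queries (A : Type) (m : oracle_comp R d A) : seq 'rV[R]_d :=
  match m with
  | Ret _ => [::]
  | AskMem z k => z :: mem_queries (k `[< K z >])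
  | AskGrad x k => mem_queries (k (grad f x))
  end.

Fixpoint grad_queries (A : Type) (m : oracle_comp R d A) : seq 'rV[R]_d :=
  match m with
  | Ret _ => [::]
  | AskMem z k => grad_queries (k `[< K z >])
  | AskGrad x k => x :: grad_queries (k (grad f x))
  end.

End Execution.
End OracleComputations.

(* [r_in] and [r_out] are the radii of the inner and outer balls around 0. *)
Record srm_params (R : realType) := SrmParams {
  rho : R; r_in : R; r_out : R; alpha : R; beta : R; G : R; H0 : R }.

Section ShrinkingRadiusMethod.
Context {R : realType}.
Variable P : srm_params R.

Definition cond_gamma : R := alpha P / beta P.
Definition cond_Gamma : R := G P / (alpha P * rho P).

Definition srm_D : R := 2 * r_out P.
Definition srm_kappa : R := beta P / alpha P.
Definition srm_a : R := 9 / rho P.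
Definition srm_b : R := srm_a * G P / alpha P.
Definition srm_theta : R := 1 / (4 * (1 + srm_b)).
Definition srm_eta : R := (1 + srm_b) / (1 + srm_b + srm_kappa).
Definition srm_sigma : R := 1 / (16 * (1 + srm_b + srm_kappa)).
Definition srm_Delta (t : nat) : R := (1 - srm_sigma) ^+ t * H0 P.
Definition srm_radius (t : nat) : R :=
  Num.min srm_D (srm_theta * Num.sqrt (2 * srm_Delta t / alpha P)).

Context {d : nat}.

Definition local_oracle_answer (K : set 'rV[R]_d) (x : 'rV[R]_d) (s : R)
    (c p : 'rV[R]_d) : Prop :=
  (K `&` eball x s) p /\
  exists2 m, is_min_on (K `&` eball x s) (inner c) m &
    inner c p <= m + srm_a * enorm c * s ^+ 2.

(* [local x s c] is the implementation of the local-oracle call. *)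
Variable local : 'rV[R]_d -> R -> 'rV[R]_d -> oracle_comp R d 'rV[R]_d.

Definition srm_step (t : nat) (x : 'rV[R]_d) : oracle_comp R d 'rV[R]_d :=
  AskGrad x (fun c =>
    bind (local x (srm_radius t) c) (fun p => Ret (x + srm_eta *: (p - x)))).

Fixpoint srm (x0 : 'rV[R]_d) (t : nat) : oracle_comp R d 'rV[R]_d :=
  match t with
  | 0%N => Ret x0
  | t'.+1 => bind (srm x0 t') (srm_step t')
  end.

Definition query_scale (eps : R) : R :=
  d%:R + r_out P / r_in P +
  alpha P * r_out P ^+ 2 * (1 + cond_Gamma) ^+ 2 / eps.

End ShrinkingRadiusMethod.

(* Main.v *)
Require Import Defs.
From HB Require Import structures.
From mathcomp Require Import all_boot all_order all_algebra.
From mathcomp Require Import all_classical all_reals all_analysis.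
From mathcomp Require Import ring lra zify.

(* Convergence. One step compares the oracle point with z = x + theta (x* - x),
   which lies in the ball of radius s_t because quadratic growth bounds |x - x*|
   by sqrt (2 Delta_t / alpha). The descent inequality then turns
   f x_t - f* <= Delta_t into f x_{t+1} - f* <= (1 - sigma) Delta_t.

   Local oracle. If s >= rho / 9 then x itself is a valid answer. Otherwise
   test x - s c/|c|; if it is outside K, bisect on the segment from x to find a
   point y of K that is extremely close to a boundary point q, with outward
   normal n. For each i, bisect for the largest t with t y + h e_i in K: since
   K lies between the tangent ball and the tangent half-space at q,
   (1 - t) / h is n_i / <n, y> up to O(h), so d one-dimensional searches give
   n up to s / (8 rho). All precisions are polynomial in 1/d, r/R and s/R,
   which costs O(log Q) queries per search. Finally K is replaced near x by the
   ball intersected with the half-space shifted inwards by 3 s^2 / rho: this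
   half-ball is contained in K, and it approximates any point of K in the ball
   within 8 s^2 / rho. *)

Set Implicit Arguments.
Unset Strict Implicit.
Unset Printing Implicit Defensive.

Import Order.TTheory GRing.Theory Num.Theory.
Import numFieldNormedType.Exports.

Local Open Scope classical_set_scope.
Local Open Scope ring_scope.

(** * Euclidean geometry of smooth bodies *)

Section EuclideanSpace.
Context {R : realType} {d : nat}.
Implicit Types (x y z u v w c p q n : 'rV[R]_d) (K A : set 'rV[R]_d).

Lemma innerC u v : inner u v = inner v u.
Proof. by apply: eq_bigr => i _; rewrite mulrC. Qed.

Lemma innerDr u v w : inner u (v + w) = inner u v + inner u w.
Proof. by rewrite -big_split; apply: eq_bigr => i _; rewrite mxE mulrDr. Qed.

Lemma innerZr u a v : inner u (a *: v) = a * inner u v.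
Proof. by rewrite mulr_sumr; apply: eq_bigr => i _; rewrite mxE mulrCA. Qed.

Lemma innerNr u v : inner u (- v) = - inner u v.
Proof. by rewrite -scaleN1r innerZr mulN1r. Qed.

Lemma innerBr u v w : inner u (v - w) = inner u v - inner u w.
Proof. by rewrite innerDr innerNr. Qed.

Lemma innerDl u v w : inner (u + v) w = inner u w + inner v w.
Proof. by rewrite innerC innerDr !(innerC w). Qed.

Lemma innerZl a u v : inner (a *: u) v = a * inner u v.
Proof. by rewrite innerC innerZr innerC. Qed.

Lemma innerNl u v : inner (- u) v = - inner u v.
Proof. by rewrite innerC innerNr innerC. Qed.

Lemma innerBl u v w : inner (u - v) w = inner u w - inner v w.
Proof. by rewrite innerDl innerNl. Qed.

Definition inner_lin :=
  (innerDr, innerDl, innerNr, innerNl, innerZr, innerZl).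

Lemma inner_ge0 u : 0 <= inner u u.
Proof. by apply: sumr_ge0 => i _; rewrite -expr2 sqr_ge0. Qed.

Lemma enorm_ge0 u : 0 <= enorm u.
Proof. exact: sqrtr_ge0. Qed.

Lemma enorm_sqr u : enorm u ^+ 2 = inner u u.
Proof. by rewrite sqr_sqrtr ?inner_ge0. Qed.

Lemma inner_delta u i : inner u (delta_mx 0 i) = u 0 i.
Proof.
rewrite /inner (bigD1 i) //= mxE !eqxx mulr1 big1 ?addr0 // => j ji.
by rewrite mxE (negbTE ji) andbF mulr0.
Qed.

Lemma enorm_delta i : enorm (delta_mx 0 i : 'rV[R]_d) = 1.
Proof. by rewrite /enorm inner_delta mxE !eqxx sqrtr1. Qed.

Lemma normr_coord_le u i : `|u 0 i| <= enorm u.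
Proof.
rewrite -sqrtr_sqr ler_sqrt ?inner_ge0 // /inner (bigD1 i) //= -expr2 lerDl.
by apply: sumr_ge0 => j _; rewrite -expr2 sqr_ge0.
Qed.

Lemma enorm_eq0 u : (enorm u == 0) = (u == 0).
Proof.
apply/eqP/eqP => [u0|->].
  apply/rowP => i; rewrite mxE; apply/eqP; rewrite -normr_eq0.
  by rewrite eq_le normr_ge0 andbT -u0 normr_coord_le.
by rewrite /enorm /inner big1 ?sqrtr0 // => i _; rewrite mxE mul0r.
Qed.

Lemma enorm0 : enorm (0 : 'rV[R]_d) = 0.
Proof. by apply/eqP; rewrite enorm_eq0. Qed.

Lemma enorm_gt0 u : (0 < enorm u) = (u != 0).
Proof. by rewrite lt_def enorm_eq0 enorm_ge0 andbT. Qed.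

Lemma enormZ a u : enorm (a *: u) = `|a| * enorm u.
Proof.
by rewrite /enorm innerZl innerZr mulrA -expr2 sqrtrM ?sqr_ge0 // sqrtr_sqr.
Qed.

Lemma enormN u : enorm (- u) = enorm u.
Proof. by rewrite -scaleN1r enormZ normrN normr1 mul1r. Qed.

Lemma enormB u v : enorm (u - v) = enorm (v - u).
Proof. by rewrite -opprB enormN. Qed.

Lemma inner0r u : inner u 0 = 0.
Proof. by rewrite /inner big1 // => i _; rewrite mxE mulr0. Qed.

Lemma inner_le u v : inner u v <= enorm u * enorm v.
Proof.
have [->|v0] := eqVneq v 0.
  by rewrite enorm0 mulr0 inner0r.
have vp : 0 < enorm v by rewrite enorm_gt0.
have := inner_ge0 (enorm v *: u - enorm u *: v).
rewrite !inner_lin (innerC v u) -!enorm_sqr => h.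
have [->|u0] := eqVneq u 0.
  by rewrite innerC inner0r enorm0 mul0r.
have up : 0 < enorm u by rewrite enorm_gt0.
rewrite -(ler_pM2l (mulr_gt0 up vp)); lra.
Qed.

Lemma inner_geN u v : - (enorm u * enorm v) <= inner u v.
Proof. by rewrite lerNl -innerNl -(enormN u) inner_le. Qed.

Lemma enormD u v : enorm (u + v) <= enorm u + enorm v.
Proof.
rewrite -ler_sqr ?nnegrE ?addr_ge0 ?enorm_ge0 // enorm_sqr !inner_lin.
rewrite (innerC v u) -!enorm_sqr; have := inner_le u v; lra.
Qed.

Lemma enorm_leB u v w : enorm (u - w) <= enorm (u - v) + enorm (v - w).
Proof. by rewrite -(subrKA v u) enormD. Qed.

Lemma enorm_le_coord u (e : R) : (forall i, `|u 0 i| <= e) ->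
  enorm u <= d%:R * e.
Proof.
move=> ue.
have -> : u = \sum_i u 0 i *: delta_mx 0 i by exact: row_sum_delta.
apply: (@le_trans _ _ (\sum_(i < d) e)); last by rewrite sumr_const card_ord mulr_natl.
elim/big_ind2 : _ => [|a a' b b' aa bb|i _]; first by rewrite enorm0.
  by apply: le_trans (enormD _ _) _; apply: lerD.
by rewrite enormZ enorm_delta mulr1.
Qed.

Definition normalize u : 'rV[R]_d := (enorm u)^-1 *: u.

Lemma enorm_normalize u v (e : R) : enorm v = 1 -> enorm (u - v) <= e ->
  enorm (normalize u - v) <= 2 * e.
Proof.
rewrite /normalize => v1 uve; have [u0|u0] := eqVneq u 0.
  by move: uve; rewrite u0 scaler0 sub0r enormN v1; lra.
have up : 0 < enorm u by rewrite enorm_gt0.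
apply: le_trans (enorm_leB _ u _) _.
rewrite -[X in _ *: u - X]scale1r -scalerBl enormZ.
have -> : `|(enorm u)^-1 - 1| * enorm u = `|1 - enorm u|.
  by rewrite -[X in _ * X](gtr0_norm up) -normrM mulrBl mulVf ?gt_eqF // mul1r.
have : `|1 - enorm u| <= e.
  have := enormD (u - v) v; have := enormD (v - u) u.
  rewrite !subrK v1 enormB ler_norml; lra.
lra.
Qed.

Lemma nonzero_dim u : u != 0 -> (0 < d)%N.
Proof.
rewrite lt0n; apply: contraNneq => d0; apply/eqP/rowP => i.
by suff: (i < 0)%N by []; rewrite -[X in (_ < X)%N]d0 ltn_ord.
Qed.

Lemma eball0P x (s : R) : eball 0 s x <-> enorm x <= s.
Proof. by rewrite /eball /= subr0. Qed.

Lemma inner_continuous u : continuous (inner u : 'rV[R]_d -> R).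
Proof.
apply: (@continuous_big _ _ _ _ _ _ _ _ (fun i y => u 0 i * y 0 i)) => [|i _ x].
  exact: add_continuous.
exact: (cvgM (cvg_cst (u 0 i)) (@coord_continuous R 1 d 0 i x)).
Qed.

Lemma enorm_continuous z : continuous (fun x => enorm (x - z)).
Proof.
move=> x; apply: (@continuous_comp _ _ _ (fun x => inner (x - z) (x - z))).
  apply: (@continuous_big _ _ _ _ _ _ _ _
    (fun i y => (y - z) 0 i * (y - z) 0 i)) => [|i _ {}x].
    exact: add_continuous.
  have cB : (y - z) 0 i @[y --> x] --> (x - z) 0 i.
    under eq_cvg do rewrite !mxE.
    rewrite !mxE.
    exact: (cvgB (@coord_continuous R 1 d 0 i x) (cvg_cst (z 0 i))).
  exact: (cvgM cB cB).
exact: sqrt_continuous.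
Qed.

Lemma closed_eball x s : closed (eball x s).
Proof.
rewrite (_ : eball x s = (fun z => enorm (z - x)) @^-1` [set t | t <= s]) //.
by apply: closed_comp => [z _|]; [exact: enorm_continuous|exact: closed_le].
Qed.

Lemma compact_eball x s : compact (eball x s).
Proof.
apply: bounded_closed_compact; last exact: closed_eball.
exists (s + enorm x); split; first exact: num_real.
move=> M sM z zs; have {}zs : enorm (z - x) <= s by []; apply/ltW; apply: le_lt_trans sM.
rewrite [leLHS]/Num.Def.normr /= mx_normrE; apply/bigmax_leP; split => [|[i j] _] /=.
  by have := enorm_ge0 (z - x); have := enorm_ge0 x; lra.
rewrite (ord1 i); apply: le_trans (normr_coord_le z j) _.
by have := enormD (z - x) x; rewrite subrK; lra.
Qed.

Lemma compact_is_min_on A (g : 'rV[R]_d -> R) :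
  A !=set0 -> compact A -> continuous g -> exists m, is_min_on A g m.
Proof.
move=> A0 cA cg.
have [c cA' cmin] := EVT_min_rV A0 cA (continuous_subspaceT cg).
exists (g c); split; first by exists c => //; exact: set_mem.
by move=> z Az; apply: cmin; exact: mem_set.
Qed.

Lemma convex_setP K x y (l : R) : convex_set (K : set (convex_lmodType 'rV[R]_d)) ->
  K x -> K y -> 0 <= l <= 1 -> K (l *: x + (1 - l) *: y).
Proof.
move=> cK Kx Ky /andP[l0 l1].
have l01 : Itv.spec (@Itv.num_sem R) (Itv.Real `[0%Z, 1%Z]) l.
  by apply/and3P; split; rewrite ?num_real//= bnd_simp.
by have := cK x y (Itv.mk l01) (mem_set Kx) (mem_set Ky) => /set_mem.
Qed.

Lemma le0_of_small (a b : R) : (forall l, 0 < l <= 1 -> a <= l * b) -> a <= 0.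
Proof.
move=> h; apply/ler_addgt0Pr => e e0; rewrite add0r.
have b0 : 0 < e / (`|b| + 1) by rewrite divr_gt0 // ltr_wpDl.
have := h (Num.min 1 (e / (`|b| + 1))).
rewrite lt_min ltr01 b0 ge_min lexx => /(_ isT) /le_trans; apply.
apply: (@le_trans _ _ (e / (`|b| + 1) * (`|b| + 1))); last first.
  by rewrite divfK // gt_eqF // ltr_wpDl.
apply: (@le_trans _ _ (Num.min 1 (e / (`|b| + 1)) * (`|b| + 1))).
  apply: ler_wpM2l; first by rewrite le_min ler01 ltW.
  by rewrite (le_trans (ler_norm b)) // lerDl.
by apply: ler_wpM2r; rewrite ?addr_ge0 // ge_min lexx orbT.
Qed.

Lemma projection_normal K y : compact K ->
    convex_set (K : set (convex_lmodType 'rV[R]_d)) -> K !=set0 -> ~ K y ->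
  exists q n, [/\ frontier K q, outward_unit_normal K q n, K q &
    forall z, K z -> enorm (q - y) <= enorm (z - y)].
Proof.
move=> cK vK K0 Ky.
have [_ [[q Kq <-] qmin]] := compact_is_min_on K0 cK (@enorm_continuous y).
have yq : 0 < enorm (y - q).
  by rewrite enorm_gt0 subr_eq0; apply: contra_notN Ky => /eqP ->.
exists q, ((enorm (y - q))^-1 *: (y - q)); split => //.
- split; first exact: subset_closure.
  move=> /= intq.
  have : \forall t \near (0 : R), K (q + t *: (y - q)).
    have : q + t *: (y - q) @[t --> (0 : R)] --> q + 0 *: (y - q).
      by apply: cvgD; [exact: cvg_cst|exact: scalel_continuous].
    by rewrite scale0r addr0; exact.
  move=> /nbhs_ballP[e /= e0 eK].
  pose t := Num.min (e / 2) (1 / 2).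
  have t0 : 0 < t by rewrite lt_min !divr_gt0.
  have te : t <= e / 2 by rewrite ge_min lexx.
  have t1 : t <= 1 / 2 by rewrite ge_min lexx orbT.
  have /eK/qmin : ball (0 : R) e t.
    by rewrite /ball /= sub0r normrN gtr0_norm //; lra.
  have -> : q + t *: (y - q) - y = (t - 1) *: (y - q).
    by apply/rowP => i; rewrite !mxE; ring.
  rewrite enormZ (enormB q) ler0_norm; last lra.
  by rewrite leNgt => /negP; apply; rewrite -subr_gt0; nra.
- split.
    by rewrite enormZ gtr0_norm ?invr_gt0 // mulVf ?gt_eqF.
  move=> z Kz; rewrite innerZl pmulr_rle0 ?invr_gt0 //.
  apply: (@le0_of_small _ (enorm (z - q) ^+ 2 / 2)) => l /andP[l0 l1].
  have /qmin : K (l *: z + (1 - l) *: q) by apply: convex_setP => //; lra.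
  rewrite -(ler_sqr (enorm_ge0 _) (enorm_ge0 _)) (enormB _ y) (enormB _ y) !enorm_sqr.
  have -> : y - (l *: z + (1 - l) *: q) = (y - q) - l *: (z - q).
    by apply/rowP => i; rewrite !mxE; ring.
  move: (y - q) (z - q) => u v.
  rewrite !inner_lin (innerC v u) => h.
  rewrite -(ler_pM2l l0); lra.
Qed.

Lemma smooth_body_sub (rho : R) K q n w : 0 < rho -> smooth_body rho K ->
  frontier K q -> outward_unit_normal K q n ->
  enorm w ^+ 2 <= - (2 * rho * inner n w) -> K (q + w).
Proof.
move=> r0 [_ sm] fq un h; apply: (sm q n fq un) => /=.
have n1 : inner n n = 1 by rewrite -enorm_sqr un.1 expr1n.
rewrite /eball /= -(ler_sqr (enorm_ge0 _) (ltW r0)) enorm_sqr.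
have -> : q + w - (q - rho *: n) = w + rho *: n.
  by apply/rowP => i; rewrite !mxE; ring.
rewrite !inner_lin n1 -enorm_sqr (innerC w); lra.
Qed.

End EuclideanSpace.

(** * Oracle programs *)

Section OraclePrograms.
Context {R : realType} {d : nat}.

Fixpoint mapM (I A : Type) (m : I -> oracle_comp R d A) (s : seq I) :
    oracle_comp R d (seq A) :=
  if s is i :: s' then bind (m i) (fun a => bind (mapM m s') (fun l => Ret (a :: l)))
  else Ret [::].

Fixpoint bisect (z : R -> 'rV[R]_d) (k : nat) (lo w : R) : oracle_comp R d R :=
  if k is k'.+1 then
    AskMem (z (lo + w / 2))
      (fun b => bisect z k' (if b then lo + w / 2 else lo) (w / 2))
  else Ret lo.

Lemma membership_only_bind (A B : Type) (m : oracle_comp R d A)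
    (h : A -> oracle_comp R d B) :
  membership_only m -> (forall a, membership_only (h a)) ->
  membership_only (bind m h).
Proof. by move=> mm hm; elim: m mm => //= z k IH mk b; exact: IH. Qed.

Lemma membership_only_mapM (I A : Type) (m : I -> oracle_comp R d A) s :
  (forall i, membership_only (m i)) -> membership_only (mapM m s).
Proof.
by move=> mm; elim: s => //= i s IH; do 2?[apply: membership_only_bind => // ?].
Qed.

Lemma membership_only_bisect z k lo w : membership_only (bisect z k lo w).
Proof. by elim: k lo w => //= k IH lo w b. Qed.

Section Execution.
Variables (K : set 'rV[R]_d) (f : 'rV[R]_d -> R).
Local Notation res := (result K f).
Local Notation memq := (mem_queries K f).
Local Notation gradq := (grad_queries K f).

Lemma result_bind (A B : Type) (m : oracle_comp R d A)
    (h : A -> oracle_comp R d B) : res (bind m h) = res (h (res m)).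
Proof. by elim: m => /=. Qed.

Lemma mem_queries_bind (A B : Type) (m : oracle_comp R d A)
    (h : A -> oracle_comp R d B) : memq (bind m h) = memq m ++ memq (h (res m)).
Proof. by elim: m => //= z k ->. Qed.

Lemma grad_queries_bind (A B : Type) (m : oracle_comp R d A)
    (h : A -> oracle_comp R d B) : gradq (bind m h) = gradq m ++ gradq (h (res m)).
Proof. by elim: m => //= z k ->. Qed.

Lemma grad_queries_membership_only (A : Type) (m : oracle_comp R d A) :
  membership_only m -> gradq m = [::].
Proof. by elim: m => //= z k IH mk; exact: IH. Qed.

Lemma result_mapM (I A : Type) (m : I -> oracle_comp R d A) s :
  res (mapM m s) = [seq res (m i) | i <- s].
Proof. by elim: s => //= i s IH; rewrite !result_bind /= IH. Qed.

Lemma size_mem_queries_mapM (I A : Type) (m : I -> oracle_comp R d A) k s :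
  (forall i, size (memq (m i)) = k) -> size (memq (mapM m s)) = (size s * k)%N.
Proof.
move=> mk; elim: s => //= i s IH.
by rewrite !mem_queries_bind /= cats0 size_cat mk IH mulSn.
Qed.

Lemma size_mem_queries_bisect z k lo w : size (memq (bisect z k lo w)) = k.
Proof. by elim: k lo w => //= k IH lo w; rewrite IH. Qed.

Lemma bisectP z k lo w : 0 <= w -> K (z lo) -> ~ K (z (lo + w)) ->
  let t := res (bisect z k lo w) in
  [/\ lo <= t <= lo + w, K (z t) & ~ K (z (t + w / 2 ^+ k))].
Proof.
elim: k lo w => [|k IH] lo w w0 Klo Kw /=.
  by rewrite expr0 divr1; split => //; lra.
rewrite exprS invfM mulrA; case: asboolP => Kmid.
  have [|||t01 Kt Kt'] // := IH (lo + w / 2) (w / 2).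
  - by lra.
  - by rewrite -addrA -splitr.
  by split => //; lra.
have [|||t01 Kt Kt'] // := IH lo (w / 2); first lra.
by split => //; lra.
Qed.

End Execution.
End OraclePrograms.

(** * Normals from finite differences and the inner half-ball *)

Section NormalEstimate.
Context {R : realType} {d : nat}.
Variables (K : set 'rV[R]_d) (rho r Ro : R).
Hypotheses (r0 : 0 < r) (rrho : r <= rho) (rhoRo : rho <= Ro).
Hypotheses (smK : smooth_body rho K) (rK : eball 0 r `<=` K).
Hypothesis KRo : K `<=` eball 0 Ro.
Variables (q n qh : 'rV[R]_d) (e : R).
Hypotheses (fq : frontier K q) (nq : outward_unit_normal K q n).
Hypotheses (Kqh : K qh) (qqh : enorm (q - qh) <= e).

Let N := inner n qh.

Lemma inner_normal_bounds : N <= inner n q <= N + e /\ r <= inner n q.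
Proof.
have n1 := nq.1.
have h1 := nq.2 qh Kqh.
have h2 := inner_le n (q - qh).
have : K (r *: n) by apply/rK/eball0P; rewrite enormZ n1 mulr1 gtr0_norm.
move=> /nq.2; rewrite innerBr innerZr -enorm_sqr n1 expr1n.
move: h1 h2 qqh; rewrite !innerBr n1 -/N => *; split; last lra.
by apply/andP; split; lra.
Qed.

Lemma step_le (h : R) : 0 < h -> 18 * Ro ^+ 2 * h <= r ^+ 3 -> 18 * h <= r.
Proof.
have [r_gt0 r_le_rho rho_le_Ro] : [/\ 0 < r, r <= rho & rho <= Ro] by [].
move=> h0 hsmall; rewrite -(ler_pM2l (exprn_gt0 2 r0)) -exprSr.
have : 18 * h * r ^+ 2 <= 18 * h * Ro ^+ 2.
  by rewrite ler_pM2l ?mulr_gt0 // ler_sqr ?nnegrE; lra.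
lra.
Qed.

Lemma finite_difference_normal (h t w : R) (i : 'I_d) :
  0 < h -> 18 * Ro ^+ 2 * h <= r ^+ 3 -> e <= h -> 0 <= t -> 0 <= w ->
  K (t *: qh + h *: delta_mx 0 i) -> ~ K ((t + w) *: qh + h *: delta_mx 0 i) ->
  `|(1 - t) * N - h * n 0 i| <= e + 18 * Ro ^+ 2 * h ^+ 2 / r ^+ 3 + w * Ro.
Proof.
have [r_gt0 r_le_rho rho_le_Ro] : [/\ 0 < r, r <= rho & rho <= Ro] by [].
move=> h0 hsmall eh t0 w0 Kt Kw.
have [/andP[Nc cN] rc] := inner_normal_bounds.
have Ro0 : 0 < Ro by lra.
have e0 : 0 <= e by apply: le_trans qqh; exact: enorm_ge0.
have hr := step_le h0 hsmall.
have Nr : r / 2 <= N by lra.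
have NRo : N <= Ro.
  have /eball0P qhR := KRo Kqh; have := inner_le n qh; rewrite nq.1 -/N; lra.
set E := 18 * Ro ^+ 2 * h ^+ 2 / r ^+ 3.
have E0 : 0 < E by rewrite divr_gt0 ?exprn_gt0 ?mulr_gt0 ?exprn_gt0.
have Eh : E <= h.
  by rewrite /E ler_pdivrMr ?exprn_gt0 // [h ^+ 2]expr2 mulrA [leLHS]mulrC ler_pM2l.
have wRo : 0 <= w * Ro by rewrite mulr_ge0 // ltW.
rewrite ler_norml; apply/andP; split; last first.
  rewrite leNgt; apply/negP => gap; apply: Kw.
  set u := t + w.
  have Nw : N * w <= w * Ro by rewrite mulrC ler_wpM2l.
  pose t1 := (N - E - h * n 0 i) / N.
  have t1N : t1 * N = N - E - h * n 0 i by rewrite divfK // gt_eqF //; lra.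
  have ut1 : u < t1.
    by rewrite -(@ltr_pM2r _ N); [rewrite t1N /u; lra|lra].
  have Kt1 : K (t1 *: qh + h *: delta_mx 0 i).
    have -> : t1 *: qh + h *: delta_mx 0 i =
        q + ((t1 - 1) *: qh + (qh - q) + h *: delta_mx 0 i).
      by apply/rowP => j; rewrite !mxE; ring.
    apply: (smooth_body_sub _ smK fq nq); first lra.
    have -> : inner n ((t1 - 1) *: qh + (qh - q) + h *: delta_mx 0 i) =
        - E + (N - inner n q).
      by rewrite !inner_lin inner_delta -/N mulrBl t1N; ring.
    have ni : `|n 0 i| <= 1 by rewrite -nq.1 normr_coord_le.
    have t11 : `|t1 - 1| <= 4 * h / r.
      rewrite ler_pdivlMr // -(@ler_pM2r _ 2^-1) // -mulrA.
      apply: (@le_trans _ _ (`|t1 - 1| * N)); first by rewrite ler_wpM2l.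
      rewrite -{1}(@gtr0_norm _ N) -?normrM; last lra.
      rewrite mulrBl t1N mul1r ler_norml; move: ni; rewrite ler_norml; nra.
    have /eball0P qhR := KRo Kqh.
    have wle : enorm ((t1 - 1) *: qh + (qh - q) + h *: delta_mx 0 i)
        <= 6 * h * Ro / r.
      apply: (@le_trans _ _ (4 * h / r * Ro + e + h)).
        apply: le_trans (enormD _ _) _; apply: lerD.
          by apply: le_trans (enormD _ _) _; apply: lerD; [rewrite enormZ;
            apply: ler_pM => //; exact: enorm_ge0|rewrite enormB].
        by rewrite enormZ enorm_delta mulr1 gtr0_norm.
      have : h * 1 <= h * (Ro / r) by rewrite ler_pM2l // ler_pdivlMr //; lra.
      by rewrite -!mulrA (mulrC r^-1); lra.
    apply: (@le_trans _ _ ((6 * h * Ro / r) ^+ 2)).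
      by rewrite ler_sqr ?nnegrE ?enorm_ge0 // (le_trans (enorm_ge0 _) wle).
    apply: (@le_trans _ _ (2 * r * E)).
      rewrite (_ : 2 * r * E = (6 * h * Ro / r) ^+ 2) // /E.
      by field; rewrite gt_eqF.
    by rewrite -mulrN -mulrA -mulrA ler_pM2l //; nra.
  have Kh : K (h *: delta_mx 0 i).
    by apply/rK/eball0P; rewrite enormZ enorm_delta gtr0_norm //; lra.
  have u0 : 0 <= u by rewrite addr_ge0.
  have t10 : 0 < t1 by lra.
  have l01 : 0 <= u / t1 <= 1.
    by rewrite divr_ge0 ?(ltW t10) // ler_pdivrMr // mul1r ltW.
  have [_ vK _] := smK.1; have := convex_setP vK Kt1 Kh l01.
  congr K; apply/rowP => j; rewrite !mxE; field; lra.
have := nq.2 _ Kt; rewrite !inner_lin inner_delta -/N; lra.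
Qed.

Lemma normal_estimate (h w : R) (t : 'I_d -> R) (err : R) :
  0 < h -> 18 * Ro ^+ 2 * h <= r ^+ 3 -> e <= h -> 0 <= w ->
  (forall i, [/\ 0 <= t i, K (t i *: qh + h *: delta_mx 0 i) &
     ~ K ((t i + w) *: qh + h *: delta_mx 0 i)]) ->
  e + 18 * Ro ^+ 2 * h ^+ 2 / r ^+ 3 + w * Ro <= h * err ->
  enorm (normalize (\row_i ((1 - t i) / h)) - n) <= 2 * (d%:R * err).
Proof.
have [r_gt0 r_le_rho rho_le_Ro] : [/\ 0 < r, r <= rho & rho <= Ro] by [].
move=> h0 hsmall eh w0 ht herr; set g := \row_i _.
have [/andP[Nc cN] rc] := inner_normal_bounds.
have hr := step_le h0 hsmall.
have N0 : 0 < N by lra.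
have -> : normalize g = normalize (N *: g).
  by rewrite /normalize enormZ gtr0_norm // invfM scalerA mulrAC mulVf ?gt_eqF // mul1r.
apply: (enorm_normalize nq.1); apply: enorm_le_coord => i.
rewrite !mxE -(ler_pM2l h0) -{1}(gtr0_norm h0) -normrM.
have -> : h * (N * ((1 - t i) / h) - n 0 i) = (1 - t i) * N - h * n 0 i.
  by field; rewrite gt_eqF.
have [t0 Kt Kw] := ht i.
by apply: le_trans herr; apply: finite_difference_normal.
Qed.

End NormalEstimate.

Section HalfBall.
Context {R : realType} {d : nat}.
Implicit Types (x c n q : 'rV[R]_d) (K : set 'rV[R]_d).

Definition half_ball (rho : R) x s n q : set 'rV[R]_d :=
  eball x s `&` [set z | inner n (z - q) <= - (3 * s ^+ 2 / rho)].

Definition half_ball_argmin rho x s n q c : 'rV[R]_d :=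
  xget x [set p | half_ball rho x s n q p /\
    forall z, half_ball rho x s n q z -> inner c p <= inner c z].

Variables (K : set 'rV[R]_d) (rho : R) (x : 'rV[R]_d) (s : R).
Hypotheses (smK : smooth_body rho K) (Kx : K x).
Hypotheses (s0 : 0 < s) (srho : 9 * s < rho).
Variables (q n qh nh : 'rV[R]_d).
Hypotheses (fq : frontier K q) (nq : outward_unit_normal K q n).
Hypotheses (Kqh : K qh) (qhx : enorm (qh - x) <= s).
Hypotheses (qqh : enorm (q - qh) <= s ^+ 2 / (8 * rho)).
Hypothesis (nnh : enorm (nh - n) <= s / (8 * rho)).

Let rho0 : 0 < rho. Proof. by apply: lt_trans srho; rewrite mulr_gt0. Qed.
Let v := s ^+ 2 / rho.
Let v0 : 0 < v. Proof. by rewrite divr_gt0 // exprn_gt0. Qed.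
Let vs : 9 * v < s.
Proof. by rewrite /v mulrA ltr_pdivrMr // expr2 mulrA [ltRHS]mulrC ltr_pM2r. Qed.
Let qqh' : enorm (q - qh) <= v / 8.
Proof. by move: qqh; rewrite invfM mulrA -mulrAC. Qed.

Let inner_err z : eball x s z -> `|inner (nh - n) (z - qh)| <= v / 4.
Proof.
move=> zs.
have zqh : enorm (z - qh) <= 2 * s.
  have := qhx; have := enorm_leB z x qh; rewrite (enormB x qh).
  by move: zs; rewrite /eball /=; lra.
have -> : v / 4 = s / (8 * rho) * (2 * s).
  by rewrite /v; field; rewrite gt_eqF.
apply: (@le_trans _ _ (enorm (nh - n) * enorm (z - qh))).
  by rewrite ler_norml inner_geN inner_le.
by apply: ler_pM => //; exact: enorm_ge0.
Qed.

Lemma half_ball_sub : half_ball rho x s nh qh `<=` K.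
Proof.
move=> z [zs /= zn].
have := inner_err zs; rewrite ler_norml => /andP[h1 h2].
have [s_gt0 s_lt_rho] : 0 < s /\ 9 * s < rho by [].
have [v_gt0 v_lt_s] : 0 < v /\ 9 * v < s by [].
have [q_qh qh_x] : enorm (q - qh) <= v / 8 /\ enorm (qh - x) <= s by [].
have h3 := nq.2 _ Kqh.
have -> : z = q + (z - q) by rewrite addrC subrK.
apply: (smooth_body_sub rho0 smK fq nq).
have zq : enorm (z - q) <= 2 * s + v / 8.
  have := enorm_leB z x q; have := enorm_leB x qh q.
  by move: zs; rewrite /eball /= (enormB x qh) (enormB qh q); lra.
have h4 : inner n (z - q) <= - (11 / 4 * v).
  have -> : z - q = (z - qh) + (qh - q) by rewrite subrKA.
  move: zn h1 h2 h3; rewrite -mulrA -/v !inner_lin; lra.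
apply: (@le_trans _ _ ((2 * s + v / 8) ^+ 2)).
  by rewrite ler_sqr ?nnegrE ?enorm_ge0 // (le_trans (enorm_ge0 _) zq).
apply: (@le_trans _ _ (2 * rho * (11 / 4 * v))); last first.
  by rewrite -mulrN ler_pM2l ?mulr_gt0 //; lra.
have -> : 2 * rho * (11 / 4 * v) = 11 / 2 * s ^+ 2.
  by rewrite /v; field; rewrite gt_eqF.
have : (2 * s + v / 8) ^+ 2 <= ((2 + 1 / 72) * s) ^+ 2.
  by rewrite ler_sqr ?nnegrE ?mulr_ge0 ?addr_ge0 //; lra.
nra.
Qed.

Lemma half_ball_approx c z : K z -> eball x s z ->
  exists2 z', half_ball rho x s nh qh z' &
    inner c z' <= inner c z + 8 * v * enorm c.
Proof.
have [s_gt0 s_lt_rho] : 0 < s /\ 9 * s < rho by [].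
have [v_gt0 q_qh] : 0 < v /\ enorm (q - qh) <= v / 8 by [].
move=> Kz zs; pose l := 4 * s / rho.
have l0 : 0 < l by rewrite divr_gt0 ?mulr_gt0.
have l1 : l < 1 by rewrite ltr_pdivrMr //; lra.
have ls : l * s = 4 * v by rewrite /l /v; field; rewrite gt_eqF.
exists (z + l *: (x - s *: n - z)).
  have zs' : eball x s (z + l *: (x - s *: n - z)).
    rewrite /eball /=.
    have -> : z + l *: (x - s *: n - z) - x = (1 - l) *: (z - x) - (l * s) *: n.
      by apply/rowP => j; rewrite !mxE; ring.
    apply: le_trans (enormD _ _) _.
    rewrite enormN !enormZ nq.1 mulr1 !gtr0_norm ?(mulr_gt0 l0 s_gt0) //; last lra.
    rewrite -[leRHS](_ : (1 - l) * s + l * s = s); last ring.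
    by rewrite lerD2r ler_wpM2l //; lra.
  split => //=.
  have := inner_err zs'; rewrite ler_norml => /andP[h1 h2].
  have h3 := inner_le n (q - qh); rewrite nq.1 mul1r in h3.
  suff h4 : inner n (z + l *: (x - s *: n - z) - q) <= - (4 * v).
    move: h1 h2 h3 h4; rewrite -mulrA -/v !inner_lin; lra.
  have -> : z + l *: (x - s *: n - z) - q
      = (1 - l) *: (z - q) + l *: (x - q) - (l * s) *: n.
    by apply/rowP => j; rewrite !mxE; ring.
  rewrite 2!innerDr innerNr 3!innerZr -(enorm_sqr n) nq.1 expr1n ls.
  have := nq.2 _ Kz; have := nq.2 _ Kx; nra.
rewrite innerDr lerD2l innerZr.
have -> : 8 * v * enorm c = l * (enorm c * (2 * s)).
  by rewrite (_ : 8 * v = 2 * (l * s)); [ring|rewrite ls; ring].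
rewrite ler_pM2l //; apply: le_trans (inner_le _ _) _.
rewrite ler_wpM2l ?enorm_ge0 //.
have -> : x - s *: n - z = (x - z) - s *: n by rewrite addrAC.
apply: le_trans (enormD _ _) _; rewrite enormN enormZ nq.1 mulr1 gtr0_norm //.
by rewrite enormB; move: zs; rewrite /eball /=; lra.
Qed.

Lemma half_ball_argminP c : let p := half_ball_argmin rho x s nh qh c in
  [/\ K p, eball x s p & forall z, K z -> eball x s z ->
     inner c p <= inner c z + 8 * s ^+ 2 / rho * enorm c].
Proof.
move=> p.
have xx : eball x s x by rewrite /eball /= subrr enorm0 ltW.
have [m [[p0 Ap0 <-] p0min]] : exists m, is_min_on (half_ball rho x s nh qh) (inner c) m.
  apply: compact_is_min_on; last exact: inner_continuous.
    by have [z Az _] := half_ball_approx c Kx xx; exists z.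
  apply: compact_closedI; first exact: compact_eball.
  rewrite (_ : [set z | _] = inner nh @^-1`
     [set t | t <= inner nh qh - 3 * s ^+ 2 / rho]).
    by apply: closed_comp => [z _|]; [exact: inner_continuous|exact: closed_le].
  by apply/seteqP; split => z /=; rewrite innerBr; lra.
have [Ap pmin] := xgetPex x (ex_intro (fun p => half_ball rho x s nh qh p /\
  forall z, half_ball rho x s nh qh z -> inner c p <= inner c z) p0 (conj Ap0 p0min)).
split; [exact: half_ball_sub|exact: Ap.1|move=> z Kz zs].
have [z' Az' z'z] := half_ball_approx c Kz zs.
by apply: le_trans (pmin _ Az') _; rewrite -(mulrA 8).
Qed.

End HalfBall.

(** * The local oracle *)

Section LocalOracle.
Context {R : realType} {d : nat}.
Variable P : srm_params R.

Definition fd_step (s : R) : R := s * r_in P ^+ 3 / (10 ^+ 3 * r_out P ^+ 3 * d%:R).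

Definition resolution (s : R) : R :=
  96 * 10 ^+ 3 * d%:R ^+ 2 * (r_out P / r_in P) ^+ 3 * (r_out P / s) ^+ 2.

Definition bits (s : R) : nat := up_log 2 (2 * (Num.truncn (resolution s)).+1).

Definition boundary_search (x u : 'rV[R]_d) (s : R) : oracle_comp R d R :=
  bisect (fun t => x - (t * s) *: u) (bits s) 0 1.

Definition slope_search (y : 'rV[R]_d) (s : R) (i : 'I_d) : oracle_comp R d R :=
  bisect (fun t => t *: y + fd_step s *: delta_mx 0 i) (bits s) 0 2.

Definition slope_normal (s : R) (ts : seq R) : 'rV[R]_d :=
  normalize (\row_(i < d) ((1 - nth 0 ts i) / fd_step s)).

Definition local_oracle (x : 'rV[R]_d) (s : R) (c : 'rV[R]_d) :
    oracle_comp R d 'rV[R]_d :=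
  if (c == 0) || (rho P <= 9 * s) then Ret x else
  let u := normalize c in
  AskMem (x - s *: u) (fun inside =>
    if inside then Ret (x - s *: u) else
    bind (boundary_search x u s) (fun t =>
      let y := x - (t * s) *: u in
      bind (mapM (slope_search y s) (enum 'I_d)) (fun ts =>
        Ret (half_ball_argmin (rho P) x s (slope_normal s ts) y c)))).

Lemma membership_only_local x s c : membership_only (local_oracle x s c).
Proof.
rewrite /local_oracle; case: ifP => //= _ [] //=.
apply: membership_only_bind => [|t /=]; first exact: membership_only_bisect.
apply: membership_only_bind => //=.
by apply: membership_only_mapM => i; exact: membership_only_bisect.
Qed.

Variables (K : set 'rV[R]_d) (f : 'rV[R]_d -> R).

Lemma size_mem_queries_local x s c :
  size (mem_queries K f (local_oracle x s c)) = 0%N \/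
  [/\ 9 * s < rho P, (0 < d)%N &
     (size (mem_queries K f (local_oracle x s c)) <= 3 * d * bits s)%N].
Proof.
rewrite /local_oracle; case: ifPn => [_|]; first by left.
rewrite negb_or -ltNge => /andP[c0 srho]; right => /=.
have d0 := nonzero_dim c0.
have b0 : (0 < bits s)%N by rewrite up_log_gt0 mulnS.
split => //; case: asboolP => _ /=; first by nia.
rewrite !mem_queries_bind /= cats0 size_cat size_mem_queries_bisect.
rewrite (@size_mem_queries_mapM _ _ K f _ _ _ (bits s)) => [|i]; last first.
  exact: size_mem_queries_bisect.
rewrite size_enum_ord; nia.
Qed.

Lemma resolution_lt s : resolution s < 2 ^+ bits s / 2.
Proof.
rewrite ltr_pdivlMr // (@lt_le_trans _ _ ((Num.truncn (resolution s)).+1%:R * 2)) //.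
  by rewrite ltr_pM2r // truncnS_gt.
by rewrite -natrM mulnC -natrX ler_nat up_logP.
Qed.

Hypotheses (r0 : 0 < r_in P) (rrho : r_in P <= rho P) (rhoRo : rho P <= r_out P).
Hypotheses (smK : smooth_body (rho P) K) (rK : eball 0 (r_in P) `<=` K).
Hypothesis KRo : K `<=` eball 0 (r_out P).

Lemma fd_bounds (s : R) : (0 < d)%N -> 0 < s -> 9 * s < rho P ->
  let h := fd_step s in let M := 2 ^+ bits s in
  [/\ 0 < h, 18 * r_out P ^+ 2 * h <= r_in P ^+ 3, s / M + s / M <= h,
     s / M + s / M <= s ^+ 2 / (8 * rho P) &
     s / M + s / M + 18 * r_out P ^+ 2 * h ^+ 2 / r_in P ^+ 3 + 2 / M * r_out P
       <= h * (s / (16 * r_out P * d%:R))].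
Proof.
move=> d0 s0 srho h M.
have [r_gt0 r_le_rho rho_le_R] : [/\ 0 < r_in P, r_in P <= rho P & rho P <= r_out P].
  by [].
have rho0 : 0 < rho P by lra.
have := resolution_lt s; rewrite /resolution -/M.
have hE : h = s * r_in P ^+ 3 / (10 ^+ 3 * r_out P ^+ 3 * d%:R) by [].
have M0 : 0 < M by rewrite exprn_gt0.
move: hE r_gt0 r_le_rho rho_le_R srho rho0 M0; rewrite -/h.
move: h M (r_in P) (r_out P) (rho P) => h M r Ro rh hE r_gt0 r_le_rho rho_le_R srho rho0 M0.
have D1 : 1 <= d%:R :> R by rewrite ler1n.
move: (d%:R : R) D1 hE => D D1 hE resM.
have R0 : 0 < Ro by lra.
have r3 : 0 < r ^+ 3 by rewrite exprn_gt0.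
have R3 : 0 < Ro ^+ 3 by rewrite exprn_gt0.
have rR3 : r ^+ 3 <= Ro ^+ 3 by apply: lerXn2r; rewrite ?nnegrE //; lra.
have h0 : 0 < h by rewrite hE divr_gt0 ?mulr_gt0 ?exprn_gt0 //; lra.
pose a := s / (Ro * D).
have RD : Ro <= Ro * D by rewrite ler_peMr // ltW.
have a0 : 0 < a by rewrite divr_gt0 ?mulr_gt0 //; lra.
have aR : a * Ro <= s.
  by rewrite /a mulrAC ler_pdivrMr ?ler_pM2l //; lra.
have a9 : 9 * a <= 1.
  by rewrite -(ler_pM2r R0); lra.
have h18 : 18 * Ro ^+ 2 * h = 18 / 10 ^+ 3 * a * r ^+ 3.
  by rewrite hE /a; field; rewrite !gt_eqF //; lra.
have hs : 10 ^+ 3 * h <= s.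
  rewrite hE mulrA ler_pdivrMr; last by rewrite !mulr_gt0 ?exprn_gt0 //; lra.
  rewrite mulrCA ler_pM2l // -mulrA ler_pM2l ?exprn_gt0 //.
  by apply: le_trans rR3 _; rewrite ler_peMr // ltW.
have iM : 192 * (Ro / M) <= h * a.
  rewrite -(ler_pM2r M0) mulrA divfK ?gt_eqF //.
  have -> : h * a * M = h * a * (M / 2) * 2 by field.
  have ha0 : 0 < h * a by rewrite mulr_gt0.
  have hM := ler_wpM2l (ltW ha0) (ltW resM).
  apply: (@le_trans _ _ (h * a *
    (96 * 10 ^+ 3 * D ^+ 2 * (Ro / r) ^+ 3 * (Ro / s) ^+ 2) * 2)).
    rewrite le_eqVlt; apply/orP; left; apply/eqP; rewrite hE /a.
    by field; rewrite !gt_eqF //; lra.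
  by rewrite ler_pM2r.
have sM : s / M <= Ro / M by rewrite ler_pM2r ?invr_gt0 //; lra.
have hah : 9 * (h * a) <= h.
  by rewrite mulrCA ler_piMr // ltW.
split => //.
- by rewrite h18 ler_piMl ?ltW //; lra.
- lra.
- apply: (@le_trans _ _ (h * a / 96)); first lra.
  rewrite ler_pdivlMr ?mulr_gt0 //.
  have : h * (a * rh) <= h * s.
    by rewrite ler_pM2l //; apply: le_trans aR; rewrite ler_pM2l.
  have : 10 ^+ 3 * h * s <= s * s by rewrite ler_pM2r.
  have : 0 < h * s by rewrite mulr_gt0.
  by rewrite expr2; lra.
- have -> : 18 * Ro ^+ 2 * h ^+ 2 / r ^+ 3 = 18 / 10 ^+ 3 * (h * a).
    by rewrite [h ^+ 2]expr2 mulrA h18; field; rewrite gt_eqF.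
  have -> : h * (s / (16 * Ro * D)) = h * a / 16.
    by rewrite /a; field; rewrite !gt_eqF //; lra.
  have : 0 < h * a by rewrite mulr_gt0.
  lra.
Qed.

Lemma local_oracle_answerI x (s : R) c p :
  compact K -> K p -> eball x s p ->
  (forall z, K z -> eball x s z ->
     inner c p <= inner c z + srm_a P * enorm c * s ^+ 2) ->
  local_oracle_answer P K x s c p.
Proof.
move=> cK Kp xp pmin; split => //.
have [|||m [[z [Kz xz] <-] zmin]] := @compact_is_min_on _ _ (K `&` eball x s) (inner c).
- by exists p.
- exact: compact_closedI cK (@closed_eball _ _ x s).
- exact: inner_continuous.
exists (inner c z); last exact: pmin.
by split; [exists z|].
Qed.

Lemma local_oracleP x (s : R) c : K x -> 0 < s ->
  local_oracle_answer P K x s c (result K f (local_oracle x s c)).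
Proof.
have [r_gt0 r_le_rho rho_le_R] : [/\ 0 < r_in P, r_in P <= rho P & rho P <= r_out P].
  by [].
move=> Kx s0; have [cK vK _] := smK.1.
have rho0 : 0 < rho P by lra.
have R0 : 0 < r_out P by lra.
have xx : eball x s x by rewrite /eball /= subrr enorm0 ltW.
have le_local z : eball x s z -> inner c x <= inner c z + enorm c * s.
  move=> xz; have := inner_geN c (z - x); rewrite innerBr.
  have := ler_wpM2l (enorm_ge0 c) xz; lra.
have err_ge0 : 0 <= srm_a P * enorm c * s ^+ 2.
  by rewrite /srm_a !mulr_ge0 ?enorm_ge0 ?invr_ge0 ?(ltW rho0) // ltW.
rewrite /local_oracle; case: ifPn => [/orP[/eqP c0|srho]|] /=.
- apply: local_oracle_answerI => // z Kz xz; have := le_local z xz.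
  by rewrite c0 enorm0; lra.
- apply: local_oracle_answerI => // z Kz xz; apply: le_trans (le_local z xz) _.
  rewrite lerD2l (mulrC (srm_a P)) -mulrA ler_wpM2l ?enorm_ge0 //.
  rewrite /srm_a expr2 mulrA ler_peMl ?(ltW s0) // mulrAC.
  by rewrite ler_pdivlMr // mul1r.
rewrite negb_or -ltNge => /andP[c0 srho].
have cp : 0 < enorm c by rewrite enorm_gt0.
set u := normalize c.
have u1 : enorm u = 1 by rewrite enormZ gtr0_norm ?invr_gt0 // mulVf ?gt_eqF.
have cu : inner c u = enorm c.
  by rewrite innerZr -enorm_sqr expr2 mulrA mulVf ?gt_eqF // mul1r.
case: asboolP => Ku /=.
  apply: local_oracle_answerI => //.
    by rewrite /eball /= addrAC subrr add0r enormN enormZ u1 mulr1 gtr0_norm.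
  move=> z Kz xz; have := le_local z xz; rewrite innerBr innerZr cu; lra.
have d0 := nonzero_dim c0.
have dR : 1 <= d%:R :> R by rewrite ler1n.
rewrite result_bind /=.
set t := result K f (boundary_search x u s); set y := x - (t * s) *: u.
have [h0 hr eh es errh] := fd_bounds d0 s0 srho.
set h := fd_step s in h0 hr eh errh; set M := 2 ^+ bits s in eh es errh.
have M0 : 0 < M by rewrite exprn_gt0.
have [||/andP[t0 t1] Ky Kyw] := @bisectP _ _ K f (fun t => x - (t * s) *: u)
  (bits s) 0 1 ler01.
- by rewrite mul0r scale0r subr0.
- by rewrite add0r mul1r.
rewrite -/(boundary_search x u s) -/t -/M in t0 t1 Ky Kyw.
have [q [n [fq nq Kq qmin]]] := projection_normal cK vK (ex_intro _ x Kx) Kyw.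
have qy : enorm (q - y) <= s / M + s / M.
  set z := x - _ in qmin.
  have yz : enorm (y - z) = s / M.
    have -> : y - z = (s / M) *: u.
      by apply/rowP => j; rewrite /y /z !mxE; field; rewrite !gt_eqF.
    by rewrite enormZ u1 mulr1 gtr0_norm // divr_gt0.
  apply: le_trans (enorm_leB q z y) _.
  by rewrite (enormB z) yz lerD2r -yz; exact: qmin.
have yx : enorm (y - x) <= s.
  rewrite /y addrAC subrr add0r enormN enormZ u1 mulr1 ger0_norm.
    by rewrite ler_piMl ?(ltW s0)//; lra.
  by rewrite mulr_ge0 // ltW.
have slopeP i : let ti := result K f (slope_search y s i) in
    [/\ 0 <= ti, K (ti *: y + h *: delta_mx 0 i) &
      ~ K ((ti + 2 / M) *: y + h *: delta_mx 0 i)].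
  have h18 := step_le r0 rrho rhoRo h0 hr.
  have [||/andP[ti0 _] Kti Ktiw] := @bisectP _ _ K f
      (fun t => t *: y + h *: delta_mx 0 i) (bits s) 0 2 (ler0n _ _) => //.
    apply/rK/eball0P; rewrite scale0r add0r enormZ enorm_delta mulr1 gtr0_norm //.
    lra.
  rewrite add0r => /nq.2; rewrite !inner_lin inner_delta.
  have [/andP[_ qN] rq] := inner_normal_bounds r0 rK nq Ky qy.
  have := normr_coord_le n i; rewrite nq.1 ler_norml => /andP[ni _].
  have : h * -1 <= h * n 0 i by rewrite ler_pM2l.
  by move: qN; rewrite !inner_lin; lra.
rewrite result_bind /= result_mapM.
set nh := slope_normal s _.
have nhE : nh = normalize (\row_i ((1 - result K f (slope_search y s i)) / h)).
  congr normalize; apply/rowP => i; rewrite !mxE.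
  by rewrite (nth_map i) ?size_enum_ord // nth_ord_enum.
have nnh : enorm (nh - n) <= s / (8 * rho P).
  have w0 : 0 <= 2 / M by rewrite divr_ge0 // ltW.
  rewrite nhE; apply: le_trans (normal_estimate r0 rrho rhoRo smK rK KRo fq nq
    Ky qy h0 hr eh w0 slopeP errh) _.
  have -> : 2 * (d%:R * (s / (16 * r_out P * d%:R))) = s / (8 * r_out P).
    by field; rewrite !gt_eqF //; lra.
  by rewrite ler_pM2l // lef_pV2 ?posrE ?mulr_gt0 // ler_pM2l.
have [Kp xp pmin] := half_ball_argminP smK Kx s0 srho fq nq Ky yx
  (le_trans qy es) nnh c.
apply: local_oracle_answerI => // z Kz xz; apply: le_trans (pmin z Kz xz) _.
rewrite lerD2l /srm_a.
have -> : 9 / rho P * enorm c * s ^+ 2 = 9 * s ^+ 2 / rho P * enorm c by ring.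
rewrite ler_wpM2r ?enorm_ge0 // ler_pM2r ?invr_gt0 // ler_pM2r ?exprn_gt0 //.
lra.
Qed.

End LocalOracle.

(** * Smooth strongly convex functions *)

Section ConvexAnalysis.
Context {R : realType} {d : nat}.
Implicit Types (K : set 'rV[R]_d) (f : 'rV[R]_d -> R) (x y : 'rV[R]_d).

Lemma le_of_halving (a b c : R) : 0 <= c ->
  (forall k, a <= b + c / 2 ^+ k) -> a <= b.
Proof.
move=> c0 h; apply/ler_addgt0Pr => e e0; apply: le_trans (h (Num.truncn (c / e)).+1) _.
rewrite lerD2l ler_pdivrMr ?exprn_gt0 // mulrC -ler_pdivrMr //.
apply: ltW; apply: lt_trans (truncnS_gt _) _.
by rewrite -natrX ltr_nat ltn_expl.
Qed.

(* Telescoping through midpoints improves the constant A to A/2 + beta/4, whose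
   fixed point is beta/2; no integration along the segment is needed. *)
Lemma descent K f (alpha beta : R) x y :
  convex_set (K : set (convex_lmodType 'rV[R]_d)) -> 0 < alpha -> 0 < beta ->
  smooth_on K beta f -> strongly_convex_on K alpha f -> K x -> K y ->
  f y <= f x + inner (grad f x) (y - x) + beta / 2 * enorm (y - x) ^+ 2.
Proof.
rewrite /smooth_on /strongly_convex_on; move: (grad f) => g.
move=> vK a0 b0 sm sc Kx Ky.
have grad_err u v w : K u -> K v ->
    inner (g u) w <= inner (g v) w + beta * enorm (u - v) * enorm w.
  move=> Ku Kv; have := inner_le (g u - g v) w; rewrite innerBl.
  have := ler_wpM2r (enorm_ge0 w) (sm _ _ Ku Kv); lra.
suff h k : forall x y, K x -> K y -> f y <= f x + inner (g x) (y - x) +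
    (beta / 2 + beta / 2 / 2 ^+ k) * enorm (y - x) ^+ 2.
  apply: (@le_of_halving _ _ (beta / 2 * enorm (y - x) ^+ 2)) => [|k].
    by rewrite mulr_ge0 ?sqr_ge0 // ltW // divr_gt0.
  by apply: le_trans (h k _ _ Kx Ky) _; lra.
elim: k => [|k IH] {Kx Ky}x {}y Kx Ky.
  have := sc _ _ Ky Kx; have := grad_err _ _ (y - x) Ky Kx.
  rewrite (enormB x y) -(opprB y x) innerNr expr0 divr1.
  have : 0 <= alpha / 2 * enorm (y - x) ^+ 2.
    by rewrite mulr_ge0 ?sqr_ge0 // ltW // divr_gt0.
  lra.
pose m := 2^-1 *: x + (1 - 2^-1) *: y.
have Km : K m by apply: convex_setP => //; lra.
have mx : m - x = 2^-1 *: (y - x) by apply/rowP => i; rewrite !mxE; lra.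
have ym : y - m = 2^-1 *: (y - x) by apply/rowP => i; rewrite !mxE; lra.
have h1 := IH _ _ Kx Km; have h2 := IH _ _ Km Ky.
have h3 := grad_err _ _ (y - m) Km Kx.
move: h1 h2 h3; rewrite mx ym !enormZ !innerZr gtr0_norm ?invr_gt0 //.
rewrite [2 ^+ k.+1]exprS invfM !exprMn; lra.
Qed.

Lemma quadratic_growth K f (alpha : R) xs y :
  convex_set (K : set (convex_lmodType 'rV[R]_d)) ->
  strongly_convex_on K alpha f -> K xs -> (forall z, K z -> f xs <= f z) ->
  K y -> f xs + alpha / 2 * enorm (y - xs) ^+ 2 <= f y.
Proof.
rewrite /strongly_convex_on; move: (grad f) => g.
move=> vK sc Kxs fmin Ky; rewrite -subr_le0.
apply: (@le0_of_small _ _ (alpha / 2 * enorm (y - xs) ^+ 2)) => l /andP[l0 l1].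
pose m := l *: y + (1 - l) *: xs.
have Km : K m by apply: convex_setP => //; lra.
have ym : y - m = (1 - l) *: (y - xs) by apply/rowP => i; rewrite !mxE; ring.
have xm : xs - m = (- l) *: (y - xs) by apply/rowP => i; rewrite !mxE; ring.
have h1 := sc _ _ Km Ky; have h2 := sc _ _ Km Kxs; have h3 := fmin _ Km.
move: h1 h2; rewrite ym xm !enormZ !innerZr !exprMn !real_normK ?num_real //.
move: (inner _ _) (enorm _ ^+ 2) => ge e h1 h2.
have l1' : 0 <= 1 - l by lra.
have := ler_wpM2l (ltW l0) h1; have := ler_wpM2l l1' h2 => k2 k1.
rewrite -(ler_pM2l l0); lra.
Qed.

Lemma smooth_ge_strongly_convex K f (alpha beta r : R) : (0 < d)%N -> 0 < r ->
  eball 0 r `<=` K -> smooth_on K beta f -> strongly_convex_on K alpha f ->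
  alpha <= beta.
Proof.
rewrite /smooth_on /strongly_convex_on; move: (grad f) => g.
move=> d0 r0 rK sm sc; pose x := r *: delta_mx 0 (Ordinal d0) : 'rV[R]_d.
have xr : enorm x = r by rewrite enormZ enorm_delta mulr1 gtr0_norm.
have Kx : K x by apply/rK/eball0P; rewrite xr.
have K0 : K 0 by apply/rK/eball0P; rewrite enorm0 ltW.
have h1 := sc _ _ Kx K0; have h2 := sc _ _ K0 Kx; have h3 := sm _ _ Kx K0.
have h4 := inner_le (g x - g 0) x.
move: h1 h2 h3 h4; rewrite sub0r subr0 enormN innerNr innerBl xr => h1 h2 h3 h4.
have := ler_wpM2r (ltW r0) h3 => h5.
rewrite -(ler_pM2r (mulr_gt0 r0 r0)); lra.
Qed.

End ConvexAnalysis.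

(** * Contraction of the optimality gap *)

Section ShrinkingRadius.
Context {R : realType}.
Variable P : srm_params R.

Definition srm_valid : Prop :=
  [/\ 0 < r_in P, r_in P <= rho P & rho P <= r_out P] /\
  [/\ 0 < alpha P, 0 < beta P & 0 <= G P].

Hypothesis valid : srm_valid.

Lemma cond_Gamma_ge0 : 0 <= cond_Gamma P.
Proof.
have [[r0 rrho _] [a0 _ G0]] := valid.
by rewrite divr_ge0 // mulr_ge0 ?ltW // (lt_le_trans r0).
Qed.

Lemma srm_bE : srm_b P = 9 * cond_Gamma P.
Proof.
have [[r0 rrho _] [a0 _ G0]] := valid.
by rewrite /srm_b /srm_a /cond_Gamma; field; rewrite !gt_eqF //; lra.
Qed.

Lemma srm_b_ge0 : 0 <= srm_b P.
Proof. by rewrite srm_bE mulr_ge0 // cond_Gamma_ge0. Qed.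

Lemma srm_kappa_gt0 : 0 < srm_kappa P.
Proof. by have [_ [a0 b0 _]] := valid; rewrite divr_gt0. Qed.

Lemma srm_sigma_itv : 0 < srm_sigma P <= 1 / 16.
Proof.
have b0 := srm_b_ge0; have k0 := srm_kappa_gt0.
rewrite /srm_sigma; move: (srm_b P) (srm_kappa P) b0 k0 => b k b0 k0.
have h : 16 <= 16 * (1 + b + k) by lra.
have h0 : 0 < 16 * (1 + b + k) by lra.
by rewrite divr_gt0 //= ler_pM2l // lef_pV2 ?posrE.
Qed.

Lemma srm_Delta_gt0 t : 0 < H0 P -> 0 < srm_Delta P t.
Proof.
have := srm_sigma_itv => /andP[s0 s1] H.
by rewrite mulr_gt0 ?exprn_gt0 //; move: (srm_sigma P) s0 s1 => s; lra.
Qed.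

Lemma srm_theta_gt0 : 0 < srm_theta P.
Proof.
have := srm_b_ge0; rewrite /srm_theta; move: (srm_b P) => b b0.
by rewrite divr_gt0 //; lra.
Qed.

Lemma srm_radius_gt0 t : 0 < H0 P -> 0 < srm_radius P t.
Proof.
move=> H; have [[r0 rrho rhoRo] [a0 _ _]] := valid.
have D0 := srm_Delta_gt0 t H.
rewrite lt_min; apply/andP; split; first by rewrite /srm_D; lra.
by rewrite mulr_gt0 ?srm_theta_gt0 // sqrtr_gt0 divr_gt0 // mulr_gt0.
Qed.

Lemma srm_radius_le t :
  srm_radius P t <= srm_theta P * Num.sqrt (2 * srm_Delta P t / alpha P).
Proof. by rewrite /srm_radius ge_min lexx orbT. Qed.

Lemma srm_radius_sqr_le t : 0 < H0 P ->
  srm_radius P t ^+ 2 <= srm_theta P ^+ 2 * (2 * srm_Delta P t / alpha P).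
Proof.
move=> H; have [_ [a0 _ _]] := valid.
have q0 : 0 <= 2 * srm_Delta P t / alpha P.
  by rewrite divr_ge0 ?(ltW a0) // mulr_ge0 // (ltW (srm_Delta_gt0 t H)).
rewrite -[X in _ * X](sqr_sqrtr q0) -exprMn.
rewrite ler_sqr ?nnegrE ?srm_radius_le ?(ltW (srm_radius_gt0 t H)) //.
by rewrite mulr_ge0 ?sqrtr_ge0 // ltW ?srm_theta_gt0.
Qed.

(* The scalar recursion behind one step: [g1], [g2] stand for the directional
   derivatives along p - x and x* - x, [e] for |p - x|^2 and [q] for s_t^2. *)
Lemma contraction_step (eta th b k h Dt g1 g2 aG be al q e h' : R) :
  0 <= b -> 0 < k -> 0 < al -> 0 < Dt -> h <= Dt ->
  th = 1 / (4 * (1 + b)) -> eta = (1 + b) / (1 + b + k) ->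
  aG = al * b -> be = al * k ->
  q <= th ^+ 2 * (2 * Dt / al) -> e <= q ->
  g1 <= th * g2 + aG * q -> g2 <= - h ->
  h' <= h + eta * g1 + be / 2 * (eta ^+ 2 * e) ->
  h' <= (1 - 1 / (16 * (1 + b + k))) * Dt.
Proof.
move=> b0 k0 al0 D0 hD thE etaE aGE beE qle eq g1le g2le h'le.
have b1 : 0 < 1 + b by lra.
have bk1 : 0 < 1 + b + k by lra.
have th0 : 0 < th by rewrite thE divr_gt0 ?mulr_gt0.
have eta0 : 0 < eta by rewrite etaE divr_gt0.
have h5 : aG * q <= 2 * b * th ^+ 2 * Dt.
  rewrite aGE (_ : 2 * b * _ * Dt = al * b * (th ^+ 2 * (2 * Dt / al))).
    by rewrite ler_wpM2l // mulr_ge0 // ltW.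
  by field; rewrite gt_eqF.
have h6 : be / 2 * e <= k * th ^+ 2 * Dt.
  rewrite beE (_ : k * _ * Dt = al * k / 2 * (th ^+ 2 * (2 * Dt / al))).
    by rewrite ler_wpM2l ?(le_trans eq) // divr_ge0 // mulr_ge0 // ltW.
  by field; rewrite gt_eqF.
have h7 : 2 * b * th <= 1 / 2.
  by rewrite thE mulrA mulr1 ler_pdivrMr ?mulr_gt0 //; lra.
have ethE : eta * th = 1 / (4 * (1 + b + k)).
  by rewrite etaE thE; field; rewrite !gt_eqF.
have h8 : k * (eta * th) <= 1 / 4.
  by rewrite ethE mulrA mulr1 ler_pdivrMr ?mulr_gt0 //; lra.
have eth0 : 0 < eta * th by rewrite mulr_gt0.
have eth1 : 0 <= 1 - eta * th.
  by rewrite subr_ge0 ethE ler_pdivrMr ?mulr_gt0 //; lra.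
have -> : 1 / (16 * (1 + b + k)) = eta * th / 4.
  by rewrite ethE; field; rewrite gt_eqF.
clear thE etaE aGE beE qle ethE b0 k0 al0 b1 bk1.
have k1 := ler_wpM2l (ltW eta0) g1le.
have k2 := ler_wpM2l (ltW (mulr_gt0 eta0 eta0)) h6.
have k3 := ler_wpM2l (ltW eta0) h5.
have k4 := ler_wpM2l (ltW eth0) g2le.
have k5 := ler_wpM2l (ltW (mulr_gt0 eth0 D0)) h7.
have k6 := ler_wpM2l (ltW (mulr_gt0 eth0 D0)) h8.
have k7 := ler_wpM2l eth1 hD.
lra.
Qed.

Section Iteration.
Context {d : nat}.
Variables (K : set 'rV[R]_d) (f : 'rV[R]_d -> R) (fstar : R).
Hypotheses (vK : convex_set (K : set (convex_lmodType 'rV[R]_d))).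
Hypothesis KR : K `<=` eball 0 (r_out P).
Hypotheses (smf : smooth_on K (beta P) f) (scf : strongly_convex_on K (alpha P) f).
Hypothesis fmin : is_min_on K f fstar.
Hypothesis fG : forall x, K x -> enorm (grad f x) <= G P.

Lemma srm_progress t x p : K x -> 0 < H0 P -> f x - fstar <= srm_Delta P t ->
  local_oracle_answer P K x (srm_radius P t) (grad f x) p ->
  let x' := x + srm_eta P *: (p - x) in
  K x' /\ f x' - fstar <= srm_Delta P t.+1.
Proof.
move=> Kx H fx [[Kp xp] [m [_ mmin] pm]] x'.
have b0 := srm_b_ge0; have k0 := srm_kappa_gt0; have th0 := srm_theta_gt0.
have [[r0 rrho rhoRo] [a0 be0 G0]] := valid.
have rho0 : 0 < rho P by exact: lt_le_trans rrho.
have D0 := srm_Delta_gt0 t H.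
have thE : srm_theta P = 1 / (4 * (1 + srm_b P)) by [].
have etaE : srm_eta P = (1 + srm_b P) / (1 + srm_b P + srm_kappa P) by [].
have eta0 : 0 < srm_eta P by rewrite etaE divr_gt0 //; lra.
have eta1 : srm_eta P <= 1 by rewrite etaE ler_pdivrMr; lra.
have th1 : srm_theta P <= 1 by rewrite thE ler_pdivrMr; lra.
have Kx' : K x'.
  have -> : x' = srm_eta P *: p + (1 - srm_eta P) *: x.
    by rewrite /x'; apply/rowP => i; rewrite !mxE; ring.
  by apply: convex_setP => //; apply/andP; split; [exact: ltW|].
split=> //.
have [[xs Kxs fxs] fge] := fmin.
have dist2 : alpha P / 2 * enorm (x - xs) ^+ 2 <= srm_Delta P t.
  apply: le_trans fx; rewrite lerBrDl -fxs.
  by apply: (quadratic_growth vK scf Kxs) => // z; rewrite fxs; exact: fge.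
pose z := x + srm_theta P *: (xs - x).
have Kz : K z.
  have -> : z = srm_theta P *: xs + (1 - srm_theta P) *: x.
    by apply/rowP => i; rewrite !mxE; ring.
  by apply: convex_setP => //; apply/andP; split; [exact: ltW|].
have zx : eball x (srm_radius P t) z.
  rewrite /eball /= /z addrAC subrr add0r enormZ gtr0_norm // enormB le_min.
  apply/andP; split.
    apply: (@le_trans _ _ (enorm (x - xs))).
      by rewrite ler_piMl ?enorm_ge0.
    have := KR Kx; have := KR Kxs; rewrite /eball /= !subr0 => h1 h2.
    by have := enormD x (- xs); rewrite enormN /srm_D; lra.
  rewrite ler_pM2l // -(ger0_norm (enorm_ge0 _)) -sqrtr_sqr.
  rewrite ler_sqrt; last by rewrite divr_ge0 ?(ltW a0) // mulr_ge0 // (ltW D0).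
  by rewrite ler_pdivlMr //; move: dist2; set e := enorm _ ^+ 2; lra.
have pz := le_trans pm (lerD (mmin z (conj Kz zx)) (lexx _)).
have h1 := scf Kx Kxs.
have h2 := descent vK a0 be0 smf scf Kx Kx'.
have hG := fG Kx.
have x'x : x' - x = srm_eta P *: (p - x) by rewrite /x' addrAC subrr add0r.
rewrite x'x innerZr enormZ gtr0_norm // exprMn in h2.
have px : enorm (p - x) ^+ 2 <= srm_radius P t ^+ 2.
  by rewrite ler_sqr ?nnegrE ?enorm_ge0 // ltW // srm_radius_gt0.
have q0 := sqr_ge0 (srm_radius P t).
rewrite /srm_Delta exprS -mulrA -/(srm_Delta P t).
move: (grad f x) pz h1 h2 hG => g pz h1 h2 hG.
apply: (contraction_step (g1 := inner g (p - x)) (g2 := inner g (xs - x))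
  (aG := srm_a P * G P) (be := beta P) b0 k0 a0 D0 fx thE etaE _ _
  (srm_radius_sqr_le t H) px).
- by rewrite /srm_b [RHS]mulrC divfK // gt_eqF.
- by rewrite /srm_kappa [RHS]mulrC divfK // gt_eqF.
- have ag : srm_a P * enorm g * srm_radius P t ^+ 2 <=
      srm_a P * G P * srm_radius P t ^+ 2.
    by rewrite ler_wpM2r // ler_wpM2l // divr_ge0 // ltW.
  move: pz ag; rewrite /z innerDr innerZr [inner g (p - x)]innerBr.
  by move: (inner g p) (inner g x) (inner g _) (srm_a P * _ * _)
    (srm_a P * _ * _) => *; lra.
- have : 0 <= alpha P / 2 * enorm (xs - x) ^+ 2.
    by rewrite mulr_ge0 ?sqr_ge0 // divr_ge0 // ltW.
  by move: h1; rewrite -fxs; set e := alpha P / 2 * _;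
    move: (inner g _) (f x) (f xs) => *; lra.
- by move: h2; set e := beta P / 2 * _; move: (inner g _) (f x) (f x') => *; lra.
Qed.

End Iteration.
End ShrinkingRadius.

(** * Iteration and query counts *)

Section Complexity.
Context {R : realType}.
Variable P : srm_params R.
Hypothesis valid : srm_valid P.

Lemma srm_Delta_le (eps : R) (n : nat) : 0 < eps -> 0 < H0 P ->
  ln (H0 P / eps) <= srm_sigma P * n%:R -> srm_Delta P n <= eps.
Proof.
move=> e0 H h; have /andP[s0 s1] := srm_sigma_itv valid.
have D0 := srm_Delta_gt0 valid n H.
rewrite -ler_ln ?posrE //; move: h; rewrite ln_div ?posrE // /srm_Delta.
have s1' : 0 < 1 - srm_sigma P by lra.
rewrite lnM ?posrE ?exprn_gt0 // lnXn //.
have : ln (1 - srm_sigma P) <= - srm_sigma P by apply: le_ln1Dx; lra.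
move=> /(ler_wMn2r n); rewrite -[- _ *+ n]mulr_natr; lra.
Qed.

Lemma srm_Delta_small (eps : R) : 0 < eps -> 0 < H0 P ->
  exists n, srm_Delta P n <= eps.
Proof.
move=> e0 H; have /andP[s0 _] := srm_sigma_itv valid.
exists (Num.truncn (ln (H0 P / eps) / srm_sigma P)).+1.
by apply: srm_Delta_le => //; rewrite [leRHS]mulrC -ler_pdivrMr // ltW // truncnS_gt.
Qed.

Definition first_below (eps : R) : nat :=
  if pselect (exists n, srm_Delta P n <= eps) is left h then ex_minn h else 0%N.

Lemma first_belowP (eps : R) : 0 < eps -> 0 < H0 P ->
  srm_Delta P (first_below eps) <= eps /\
  forall n, srm_Delta P n <= eps -> (first_below eps <= n)%N.
Proof.
move=> e0 H; rewrite /first_below; case: pselect => [h|[]]; last exact: srm_Delta_small.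
by case: ex_minnP.
Qed.

(* In dimension 0 the condition number beta / alpha may be arbitrarily small,
   but then a single step already satisfies the claim. *)
Definition srm_niter (d : nat) (eps : R) : nat :=
  if d == 0%N then 1%N else first_below eps.

Lemma srm_niter_Delta d (eps : R) : 0 < eps -> eps < H0 P ->
  (0 < srm_niter d eps)%N /\
  forall t, (t < srm_niter d eps)%N -> eps < srm_Delta P t.
Proof.
move=> e0 eH; have H := lt_trans e0 eH.
have D0 : eps < srm_Delta P 0 by rewrite /srm_Delta expr0 mul1r.
rewrite /srm_niter; case: ifP => _; first by split => // -[].
have [le_eps least] := first_belowP e0 H; split.
  by rewrite lt0n; apply: contraTneq D0 => n0; rewrite -leNgt -n0.
by move=> t; apply: contraTT; rewrite -leNgt -leqNgt; exact: least.
Qed.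

Lemma srm_niter_le d (eps C : R) : 0 < eps -> eps < H0 P ->
  1000 <= C -> ((0 < d)%N -> alpha P <= beta P) ->
  ((srm_niter d eps)%:Z <=
    Num.ceil (C * ((cond_gamma P)^-1 + cond_Gamma P) * ln (H0 P / eps)))%R.
Proof.
move=> e0 eH C1 ab; have H := lt_trans e0 eH.
have Ga0 := cond_Gamma_ge0 valid; have k0 := srm_kappa_gt0 valid.
rewrite /cond_gamma invf_div -/(srm_kappa P).
have L0 : 0 < ln (H0 P / eps) by rewrite ln_gt0 // ltr_pdivlMr // mul1r.
set L := ln _ in L0 *.
have X0 : 0 < C * (srm_kappa P + cond_Gamma P) * L.
  by rewrite !mulr_gt0 //; lra.
rewrite /srm_niter; case: ifPn => [_|d0]; first by rewrite -gtz0_ge1 ceil_gt0.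
have [n nE] : exists n : nat, Num.ceil (C * (srm_kappa P + cond_Gamma P) * L) = n%:Z.
  have : (0 <= Num.ceil (C * (srm_kappa P + cond_Gamma P) * L))%R.
    by rewrite ltW // ceil_gt0.
  by case: (Num.ceil _) => // n _; exists n.
have := ceil_ge (C * (srm_kappa P + cond_Gamma P) * L); rewrite nE => nge.
rewrite lez_nat; apply: (first_belowP e0 H).2; apply: srm_Delta_le => //.
have k1 : 1 <= srm_kappa P.
  have [_ [a0 _ _]] := valid.
  by rewrite /srm_kappa ler_pdivlMr // mul1r ab // lt0n.
rewrite -/L /srm_sigma (srm_bE valid) mulrAC mul1r ler_pdivlMr; last lra.
apply: le_trans nge; rewrite mulrC ler_pM2r //.
have : 1000 * (srm_kappa P + cond_Gamma P) <= C * (srm_kappa P + cond_Gamma P).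
  by rewrite ler_pM2r //; lra.
lra.
Qed.

Section Queries.
Variable d : nat.
Local Notation Q eps := (query_scale P (d := d) eps).

Lemma query_scale_bounds (eps : R) : 0 < eps ->
  [/\ d%:R + 1 <= Q eps, d%:R <= Q eps, r_out P / r_in P <= Q eps &
    alpha P * r_out P ^+ 2 * (1 + cond_Gamma P) ^+ 2 / eps <= Q eps].
Proof.
move=> e0; have [[r0 rrho rhoRo] [a0 _ _]] := valid.
have R0 : 0 < r_out P by lra.
have h1 : 1 <= r_out P / r_in P by rewrite ler_pdivlMr // mul1r; lra.
have h2 : 0 <= alpha P * r_out P ^+ 2 * (1 + cond_Gamma P) ^+ 2 / eps.
  by rewrite divr_ge0 ?(ltW e0) // mulr_ge0 ?sqr_ge0 // mulr_ge0 ?sqr_ge0 // ltW.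
have h3 : 0 <= d%:R :> R by [].
rewrite /query_scale; split; lra.
Qed.

Lemma radius_ratio_le (eps : R) t : 0 < eps -> 0 < H0 P ->
  eps <= srm_Delta P t -> 9 * srm_radius P t < rho P ->
  (r_out P / srm_radius P t) ^+ 2 <= 2 ^+ 10 * Q eps.
Proof.
move=> e0 H eD srho; have s0 := srm_radius_gt0 valid t H.
have [[r0 rrho rhoRo] [a0 _ _]] := valid.
have [_ _ _ hQ] := query_scale_bounds e0.
have Ga0 := cond_Gamma_ge0 valid.
have D0 := srm_Delta_gt0 valid t H.
have sE : srm_radius P t = srm_theta P * Num.sqrt (2 * srm_Delta P t / alpha P).
  rewrite /srm_radius; case: (leP (srm_D P)) => // h.
  by move: srho; rewrite /srm_radius min_l // /srm_D; lra.
have s2 : srm_radius P t ^+ 2 = srm_theta P ^+ 2 * (2 * srm_Delta P t / alpha P).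
  by rewrite sE exprMn sqr_sqrtr // divr_ge0 ?(ltW a0) // mulr_ge0 // ltW.
rewrite expr_div_n ler_pdivrMr ?exprn_gt0 // s2.
have thE : srm_theta P = 1 / (4 * (1 + 9 * cond_Gamma P)).
  by rewrite /srm_theta (srm_bE valid).
rewrite thE; move: (cond_Gamma P) Ga0 hQ => g g0 hQ.
have g1 : 0 < 1 + 9 * g by lra.
pose D := srm_Delta P t; rewrite -/D in eD D0 *.
have {}hQ : alpha P * r_out P ^+ 2 * (1 + g) ^+ 2 <= Q eps * D.
  move: hQ; rewrite ler_pdivrMr // => /le_trans; apply.
  rewrite ler_wpM2l //.
  by have [h1 _ _ _] := query_scale_bounds e0; apply: le_trans h1; rewrite addr_ge0.
have -> : 2 ^+ 10 * Q eps * ((1 / (4 * (1 + 9 * g))) ^+ 2 * (2 * D / alpha P)) =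
   2 ^+ 7 * (Q eps * D) / (alpha P * (1 + 9 * g) ^+ 2).
  by field; rewrite !gt_eqF.
rewrite ler_pdivlMr ?mulr_gt0 ?exprn_gt0 //.
apply: (@le_trans _ _ (2 ^+ 7 * (alpha P * r_out P ^+ 2 * (1 + g) ^+ 2))); last first.
  by rewrite ler_pM2l // exprn_gt0.
have R2 : 0 <= alpha P * r_out P ^+ 2 by rewrite mulr_ge0 ?sqr_ge0 // ltW.
have gg : (1 + 9 * g) ^+ 2 <= 2 ^+ 7 * (1 + g) ^+ 2.
  have := sqr_ge0 g; rewrite !sqrrD; lra.
have := ler_wpM2l R2 gg; lra.
Qed.

Lemma bits_le (eps : R) t : (0 < d)%N -> 0 < eps -> 0 < H0 P ->
  eps <= srm_Delta P t -> 9 * srm_radius P t < rho P ->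
  (bits (d := d) P (srm_radius P t))%:R * ln 2 <= 36 * ln (Q eps).
Proof.
move=> d0 e0 H eD srho.
have [[r0 rrho rhoRo] [a0 _ _]] := valid.
have R0 : 0 < r_out P by lra.
have s0 := srm_radius_gt0 valid t H.
have hs := radius_ratio_le e0 H eD srho.
have [Q1 Qd Qr _] := query_scale_bounds e0.
have Q2 : 2 <= Q eps by apply: le_trans Q1; rewrite lerD2r // ler1n.
set q := Q eps in hs Q1 Qd Qr Q2 *.
set s := srm_radius P t in hs s0 *.
have q0 : 0 < q by lra.
have rR0 : 0 <= r_out P / r_in P by rewrite divr_ge0 // ltW.
have D2 : 0 <= d%:R ^+ 2 :> R by exact: sqr_ge0.
have c0 : 0 <= 96 * 10 ^+ 3 :> R by rewrite mulr_ge0 ?exprn_ge0.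
have cD0 : 0 <= 96 * 10 ^+ 3 * d%:R ^+ 2 :> R by exact: mulr_ge0.
have rR3 : 0 <= (r_out P / r_in P) ^+ 3 by exact: exprn_ge0.
have res : resolution (d := d) P s <= 2 ^+ 27 * q ^+ 6.
  have -> : 2 ^+ 27 * q ^+ 6 = 2 ^+ 17 * q ^+ 2 * q ^+ 3 * (2 ^+ 10 * q).
    by rewrite (exprD _ 17 10) (exprD q 3 3) [q ^+ 3]exprS; ring.
  rewrite /resolution; apply: ler_pM; [exact: mulr_ge0|exact: sqr_ge0| |exact: hs].
  apply: ler_pM => //; last by apply: lerXn2r => //; rewrite nnegrE // ltW.
  apply: ler_pM => //; last by apply: lerXn2r => //; rewrite nnegrE // ltW.
  lra.
have res0 : 0 <= resolution (d := d) P s.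
  by rewrite /resolution; apply: mulr_ge0; [exact: mulr_ge0|exact: sqr_ge0].
have pow : 2 ^+ bits (d := d) P s <= 4 * (resolution (d := d) P s + 1).
  rewrite /bits; set n := (Num.truncn _).+1.
  have nle : n%:R <= resolution (d := d) P s + 1.
    by rewrite /n -addn1 natrD lerD2r truncn_le.
  have n0 : (0 < n)%N by [].
  move: n n0 nle => n n0 nle.
  have : (2 ^ (up_log 2 (2 * n)) <= 4 * n)%N.
    have b0 : (0 < up_log 2 (2 * n))%N by rewrite up_log_gt0; move: n0; clear; lia.
    have : (2 ^ (up_log 2 (2 * n)).-1 < 2 * n)%N.
      by rewrite up_log_gtn //; move: n0; clear; lia.
    case: (up_log 2 _) b0 => // k _ /=; rewrite expnS.
    by move: (2 ^ k)%N => m; clear; lia.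
  rewrite -(ler_nat R) natrX natrM => /le_trans; apply.
  by rewrite ler_pM2l.
have {}pow : 2 ^+ bits (d := d) P s <= q ^+ 36.
  apply: le_trans pow _; apply: (@le_trans _ _ (2 ^+ 30 * q ^+ 6)).
    have : 1 <= 2 ^+ 27 * q ^+ 6.
      by apply: mulr_ege1; apply: exprn_ege1; lra.
    rewrite (exprD _ 3 27) -mulrA; move: res.
    by move: (_ ^+ 27 * _ ^+ 6) => y; lra.
  rewrite (exprD q 30 6) ler_pM2r ?exprn_gt0 //.
  by apply: lerXn2r => //; rewrite nnegrE // ltW.
by rewrite !mulr_natl -!lnXn // ler_ln // posrE exprn_gt0.
Qed.

End Queries.
End Complexity.

Lemma local_queries_le (R : realType) (P : srm_params R) (d : nat)
    (K : set 'rV[R]_d) (f : 'rV[R]_d -> R) (C eps : R) t x c :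
  srm_valid P -> 0 < eps -> 0 < H0 P -> eps <= srm_Delta P t ->
  0 <= C -> 108 <= C * ln 2 ->
  (size (mem_queries K f (local_oracle P x (srm_radius P t) c)))%:R <=
    C * d%:R * ln (query_scale P (d := d) eps).
Proof.
move=> valid e0 H eD C0 Cl2.
have [Q1 _ _ _] := query_scale_bounds valid d e0.
have lQ : 0 <= ln (query_scale P (d := d) eps).
  by apply: ln_ge0; apply: le_trans Q1; rewrite lerDr.
have d0 : 0 <= d%:R :> R by [].
case: (size_mem_queries_local P K f x (srm_radius P t) c) => [->|[srho dpos le]].
  by apply: mulr_ge0 => //; exact: mulr_ge0.
have bl := bits_le valid dpos e0 H eD srho.
apply: (@le_trans _ _ (3 * d * bits (d := d) P (srm_radius P t))%:R).
  by rewrite ler_nat.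
rewrite !natrM.
move: (_ (bits _ _)) (ln (query_scale _ _)) lQ bl => b q q0 bl.
have l2 : 0 < ln 2 :> R by rewrite ln_gt0 // ltr1n.
rewrite -(ler_pM2r l2).
have h1 := ler_wpM2l d0 bl.
have h2 := ler_wpM2r (mulr_ge0 d0 q0) Cl2.
move: h1 h2; move: (ln 2 : R) (d%:R : R) => l e; lra.
Qed.

Theorem corollary3p2 (R : realType) :
  exists C : R, 0 < C /\
  forall (d : nat) (P : srm_params R),
    0 < r_in P -> r_in P <= rho P -> rho P <= r_out P ->
    0 < alpha P -> 0 < beta P ->
  (* the implementation of the local oracle and the number of iterations are
     fixed before K, f and x0, from the known parameters only *)
  exists (local : 'rV[R]_d -> R -> 'rV[R]_d -> oracle_comp R d 'rV[R]_d)
         (niter : R -> nat),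
    (forall x s c, membership_only (local x s c)) /\
    forall (K : set 'rV[R]_d) (f : 'rV[R]_d -> R) (fstar : R) (x0 : 'rV[R]_d),
      smooth_body (rho P) K ->
      eball 0 (r_in P) `<=` K -> K `<=` eball 0 (r_out P) ->
      differentiable_around K f ->
      smooth_on K (beta P) f ->
      strongly_convex_on K (alpha P) f ->
      is_min_on K f fstar ->
      K x0 ->
      f x0 - fstar <= H0 P ->
      (forall x, K x -> enorm (grad f x) <= G P) ->
    forall eps : R, 0 < eps -> eps < H0 P ->
      let T := niter eps in
      let x t := result K f (srm P local x0 t) in
      let c t := grad f (x t) in
      let s t := srm_radius P t in
      let p t := result K f (local (x t) (s t) (c t)) in
      [/\ (1 <= T)%N /\
          (T%:Z <= Num.ceil (C * ((cond_gamma P)^-1 + cond_Gamma P)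
                               * ln (H0 P / eps)))%R,
          K (x T) /\ f (x T) - fstar <= eps,
          forall t : nat, (t < T)%N ->
            [/\ local_oracle_answer P K (x t) (s t) (c t) (p t),
                grad_queries K f (srm_step P local t (x t)) = [:: x t]
              & (size (mem_queries K f (srm_step P local t (x t))))%:R
                  <= C * d%:R * ln (query_scale P (d := d) eps)],
          grad_queries K f (srm P local x0 T) = [seq x t | t <- iota 0 T]
        & (size (mem_queries K f (srm P local x0 T)))%:R
            <= C * d%:R * T%:R * ln (query_scale P (d := d) eps)].
Proof.
have l2 : 0 < ln 2 :> R by rewrite ln_gt0 // ltr1n.
have [C [C0 C1 Cl2]] : exists C : R, [/\ 0 < C, 1000 <= C & 108 <= C * ln 2].
  have l1 : ln 2 <= 1 :> R by apply: (@le_ln1Dx _ 1); lra.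
  exists (1000 / ln 2); move: (ln 2 : R) l2 l1 => l l2 l1; split.
  - by apply: divr_gt0; lra.
  - by rewrite (ler_pdivlMr _ _ l2); lra.
  - by rewrite (divfK (lt0r_neq0 l2)); lra.
exists C; split=> //.
move=> d P r0 rrho rhoRo a0 b0; exists (local_oracle P), (srm_niter P d).
split; first exact: membership_only_local.
move=> K f fstar x0 smK rK KR _ smf scf fmin Kx0 fx0 fG eps e0 eH T x c s p.
have H := lt_trans e0 eH.
have valid : srm_valid P.
  by do 2?split => //; apply: le_trans (fG _ Kx0); exact: enorm_ge0.
have [_ vK _] := smK.1.
have [T0 TD] := srm_niter_Delta valid d e0 eH.
have xS t : x t.+1 = x t + srm_eta P *: (p t - x t).
  by rewrite /x /= result_bind /= result_bind.
have local_ok t : K (x t) -> local_oracle_answer P K (x t) (s t) (c t) (p t).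
  by move=> Kx; apply: local_oracleP => //; exact: srm_radius_gt0.
have iterate t : K (x t) /\ f (x t) - fstar <= srm_Delta P t.
  elim: t => [|t [Kx fx]]; first by rewrite /srm_Delta expr0 mul1r.
  by rewrite xS; exact: (srm_progress valid vK KR smf scf fmin fG Kx H fx (local_ok t Kx)).
have queries t : (t < T)%N ->
    (size (mem_queries K f (srm_step P (local_oracle P) t (x t))))%:R <=
    C * d%:R * ln (query_scale P (d := d) eps).
  move=> tT; rewrite /= mem_queries_bind /= cats0.
  by apply: local_queries_le => //; rewrite ltW // TD.
have step_grad t y : grad_queries K f (srm_step P (local_oracle P) t y) = [:: y].
  rewrite /= grad_queries_bind /= cats0 grad_queries_membership_only //.
  exact: membership_only_local.
split.
- split=> //; apply: srm_niter_le => // d0.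
  exact: (smooth_ge_strongly_convex d0 r0 rK smf scf).
- split; first exact: (iterate T).1.
  have [d0|d0] := eqVneq d 0%N.
    have [[xs Kxs <-] _] := fmin.
    have -> : x T = xs.
      by apply/rowP => i; suff: (i < 0)%N by []; rewrite -[X in (_ < X)%N]d0 ltn_ord.
    by rewrite subrr ltW.
  apply: le_trans (iterate T).2 _.
  by rewrite /T /srm_niter (negbTE d0); exact: (first_belowP valid e0 H).1.
- by move=> t tT; split; [exact: local_ok (iterate t).1|exact: step_grad|exact: queries].
- elim: T {T0 TD queries} => // n IH.
  have -> : iota 0 n.+1 = iota 0 n ++ [:: n] by rewrite -addn1 iotaD.
  by rewrite [srm _ _ _ _]/= grad_queries_bind IH step_grad map_cat.
have : forall n, (n <= T)%N ->
    (size (mem_queries K f (srm P (local_oracle P) x0 n)))%:R <=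
    n%:R * (C * d%:R * ln (query_scale P (d := d) eps)).
  elim=> [|n IH] nT; first by rewrite mul0r.
  rewrite [srm _ _ _ _]/= mem_queries_bind size_cat natrD mulrSr mulrDl mul1r.
  by apply: lerD; [exact: IH (ltnW nT)|exact: queries].
by move=> /(_ T (leqnn T)) /le_trans; apply; rewrite mulrA [_%:R * (C * _)]mulrC.
Qed.
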